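(* Let $M$ be a surface immersed in $\mathbb R^4$. Let $e\in\mathfrak X(M)$ be such that $\nabla^\top_Xe=X$ for all $X\in\mathfrak X(M)$ (hence $M$ is flat), and define $f:M\to\mathbb R^4$ by $f(p)=p-e_p$. If $f$ is an immersion, then the immersed surface $f(M)$ is semiumbilical (and is called an envelope of $M$). If, in addition, $M$ is semiumbilical, then $f(M)$ is flat.
   Context: $M$ is a smooth 2-dimensional surface immersed in $\mathbb R^4$; since everything is local it may be regarded as embedded. $T_pM$ and $N_pM=(T_pM)^\bot$ are regarded as vector subspaces of $\mathbb R^4$; $\cdot$ is the standard inner product; $\mathfrak X(M)$ is the space of smooth tangent vector fields, regarded as $\mathbb R^4$-valued maps. $D$ is the ordinary directional derivative; $\nabla^\top_XY=(D_XY)^\top$ and $\alpha(X,Y)=(D_XY)^\bot$ are its tangential and normal components for tangent fields. A surface is flat if the curvature of $\nabla^\top$ is zero everywhere. The curvature ellipse at $p$ is $\{\alpha_p(t,t)/(t\cdot t): t\in T_pM\setminus\{0\}\}\subset N_pM$. A point $p$ is semiumbilic if its curvature ellipse lies in an affine line (a segment or a point), and a point of inflection if it lies in an affine line through the origin of $N_pM$ (umbilic points, where the ellipse is a single point, count as inflection points). A surface is called semiumbilical if all its points are semiumbilic and none is a point of inflection; i.e. at each point the curvature ellipse is a nondegenerate segment not collinear with the origin. (Semiumbilicity of all points is equivalent to the normal bundle being flat.) When $f$ is an immersion, $f(M)$ is regarded as a surface immersed in $\mathbb R^4$ via $f$. *)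

(* Defs.v *)
From HB Require Import structures.
From mathcomp Require Import all_boot all_order all_algebra.
From mathcomp Require Import all_classical all_reals all_analysis.
Set Implicit Arguments.
Unset Strict Implicit.
Unset Printing Implicit Defensive.
Import Order.TTheory GRing.Theory Num.Theory.
Import numFieldNormedType.Exports.
Local Open Scope classical_set_scope.
Local Open Scope ring_scope.

(* f is of class C^k at every point of U; U is meant to be open, so that only
   the values of the total function f on U matter. *)
Fixpoint Ck_on (R : realType) (V W : normedModType R) (k : nat) (U : set V)
    (f : V -> W) : Prop :=
  match k with
  | 0 => forall x, U x -> {for x, continuous f}
  | k'.+1 => (forall x, U x -> differentiable f x) /\
             (forall v : V, Ck_on k' U ('D_v f))
  end.

Definition smooth_on (R : realType) (V W : normedModType R) (U : set V)
    (f : V -> W) : Prop :=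
  forall k, Ck_on k U f.

(* Homeomorphism chart_map, with inverse chart_inv, between an open subset of M
   and an open subset of R^2. Both maps are total functions whose values
   outside chart_dom and chart_cod are irrelevant. *)
Record chart (R : realType) (M : topologicalType) := Chart {
  chart_dom : set M;
  chart_cod : set 'rV[R]_2;
  chart_map : M -> 'rV[R]_2;
  chart_inv : 'rV[R]_2 -> M;
  chart_dom_open : open chart_dom;
  chart_cod_open : open chart_cod;
  chart_map_cod : forall p, chart_dom p -> chart_cod (chart_map p);
  chart_inv_dom : forall x, chart_cod x -> chart_dom (chart_inv x);
  chart_mapK : forall p, chart_dom p -> chart_inv (chart_map p) = p;
  chart_invK : forall x, chart_cod x -> chart_map (chart_inv x) = x;
  chart_map_continuous :
    forall p, chart_dom p -> {for p, continuous chart_map};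
  chart_inv_continuous :
    forall x, chart_cod x -> {for x, continuous chart_inv}
}.

Record smoothSurface (R : realType) := SmoothSurface {
  surface_space :> topologicalType;
  surface_hausdorff : hausdorff_space surface_space;
  surface_second_countable : @second_countable surface_space;
  atlas : set (chart R surface_space);
  atlas_cover : forall p, exists2 c, atlas c & chart_dom c p;
  atlas_compat : forall c c', atlas c -> atlas c' ->
    smooth_on [set x | chart_cod c x /\ chart_dom c' (chart_inv c x)]
              (chart_map c' \o chart_inv c)
}.

Definition dotv (R : realType) (n : nat) (u v : 'rV[R]_n) : R :=
  \sum_(i < n) u ord0 i * v ord0 i.

Section ImmersedSurface.
Variables (R : realType) (M : smoothSurface R).
Implicit Types (g X Y Z : M -> 'rV[R]_4) (p : M) (s t v : 'rV[R]_4).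

Definition chart_at (c : chart R M) p : Prop := atlas c /\ chart_dom c p.

(* Derivative at p of an R^4-valued map on M along the tangent vector whose
   coordinates in the chart c are w. *)
Definition chart_derive (c : chart R M) g p (w : 'rV[R]_2) : 'rV[R]_4 :=
  'D_w (g \o chart_inv c) (chart_map c p).

Definition smooth_map g : Prop :=
  forall c, atlas c -> smooth_on (chart_cod c) (g \o chart_inv c).

Definition immersion g : Prop :=
  smooth_map g /\
  forall p c, chart_at c p -> injective (chart_derive c g p).

(* Below, g is the immersion through which M is a surface in R^4. *)

Definition tangent_space g p : set 'rV[R]_4 :=
  [set t | exists c w, chart_at c p /\ t = chart_derive c g p w].

Definition normal_space g p : set 'rV[R]_4 :=
  [set v | forall t, tangent_space g p t -> dotv v t = 0].

Definition tangent_part g p v : 'rV[R]_4 :=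
  xget 0 [set t | tangent_space g p t /\ normal_space g p (v - t)].

Definition normal_part g p v : 'rV[R]_4 := v - tangent_part g p v.

Definition tangent_field g X : Prop :=
  smooth_map X /\ forall p, tangent_space g p (X p).

(* D_t Y at p, for t in the tangent space at p regarded as a subspace of R^4. *)
Definition dir_derive g Y p t : 'rV[R]_4 :=
  xget 0 [set z | exists c w, [/\ chart_at c p,
                                  t = chart_derive c g p w &
                                  z = chart_derive c Y p w]].

Definition field_derive g X Y : M -> 'rV[R]_4 :=
  fun p => dir_derive g Y p (X p).

Definition nabla g X Y : M -> 'rV[R]_4 :=
  fun p => tangent_part g p (field_derive g X Y p).

Definition second_form g X Y : M -> 'rV[R]_4 :=
  fun p => normal_part g p (field_derive g X Y p).

Definition lie_bracket g X Y : M -> 'rV[R]_4 :=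
  fun p => field_derive g X Y p - field_derive g Y X p.

Definition curvature g X Y Z : M -> 'rV[R]_4 :=
  fun p => nabla g X (nabla g Y Z) p - nabla g Y (nabla g X Z) p
           - nabla g (lie_bracket g X Y) Z p.

Definition flat g : Prop :=
  forall X Y Z, tangent_field g X -> tangent_field g Y -> tangent_field g Z ->
  forall p, curvature g X Y Z p = 0.

(* alpha_p(t,t) is the value at p of alpha(X,X) for a tangent field X with
   X_p = t; every tangent vector at p extends to such a field, e.g. by
   projecting a constant vector of R^4 to the tangent planes. *)
Definition curvature_ellipse g p : set 'rV[R]_4 :=
  [set v | exists t X,
    [/\ tangent_space g p t, t != 0, tangent_field g X, X p = t &
        v = (dotv t t)^-1 *: second_form g X X p]].

Definition affine_line_in (N L : set 'rV[R]_4) : Prop :=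
  exists a d, [/\ N a, N d, d != 0 & L = [set a + r *: d | r in [set: R]]].

Definition semiumbilic_at g p : Prop :=
  exists2 L, affine_line_in (normal_space g p) L & curvature_ellipse g p `<=` L.

Definition inflection_at g p : Prop :=
  exists L, [/\ affine_line_in (normal_space g p) L, L 0 &
                curvature_ellipse g p `<=` L].

Definition semiumbilical g : Prop :=
  forall p, semiumbilic_at g p /\ ~ inflection_at g p.

End ImmersedSurface.

(* Main.v *)
From HB Require Import structures.
From mathcomp Require Import all_boot all_order all_algebra.
From mathcomp Require Import all_classical all_reals all_analysis.
From mathcomp Require Import ring lra.
Require Import Defs.
Set Implicit Arguments.
Unset Strict Implicit.
Unset Printing Implicit Defensive.
Import Order.TTheory GRing.Theory Num.Theory.
Import numFieldNormedType.Exports.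
Local Open Scope classical_set_scope.
Local Open Scope ring_scope.

(* In a chart write h, eps and phi = h - eps for x, e and f, and let indices
   denote partial derivatives.  Since the tangential part of eps_i is h_i, every
   phi_i is normal to M, so the tangent planes of f(M) are the normal planes of
   M.  Differentiating phi_j . h_k = 0 shows that phi_ij . h_k = - phi_j . h_ik,
   a cubic form which is totally symmetric because h and phi both have symmetric
   second derivatives.
   - Flatness of M: writing eps = a h_1 + b h_2, so that phi_j is minus
     a alpha_1j + b alpha_2j, the symmetry of the cubic form says that a K =
     b K = 0, where K is the Gauss expression alpha_11 . alpha_22 - alpha_12^2.
     Where a = b = 0, differentiating b K = 0 along the second coordinate gives
     K = 0, because there b_2 = 1.
   - Semiumbilicity of f(M): differentiating phi_j . eps = 0 gives phi_ij . eps =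
     phi_i . phi_j, so the curvature ellipse of f lies on the line v . eps = 1 of
     the tangent plane of M.  If it also lay on a line through the origin it
     would be a single point m, and the cubic form would be phi_i . phi_j times
     m . h_k; total symmetry then forces m = 0, contradicting m . eps = 1.
   - Flatness of f(M): if the ellipse of M lies on a line, some nonzero normal
     vector n, hence some nonzero combination of phi_1 and phi_2, satisfies
     h_ij . n = k h_i . h_j.  Thus a contraction of the cubic form is a multiple
     of the metric, which makes the Gauss expression of f vanish. *)

(** * The Euclidean inner product on row vectors *)

Section DotProduct.
Context {R : realType} {n : nat}.
Implicit Types u v w : 'rV[R]_n.

Lemma dotvC u v : dotv u v = dotv v u.
Proof. by apply: eq_bigr => i _; rewrite mulrC. Qed.

Lemma dotvDl u v w : dotv (u + v) w = dotv u w + dotv v w.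
Proof. by rewrite -big_split; apply: eq_bigr => i _; rewrite mxE mulrDl. Qed.

Lemma dotvZl k u w : dotv (k *: u) w = k * dotv u w.
Proof. by rewrite /dotv mulr_sumr; apply: eq_bigr => i _; rewrite mxE mulrA. Qed.

Lemma dotvDr u v w : dotv u (v + w) = dotv u v + dotv u w.
Proof. by rewrite dotvC dotvDl !(dotvC u). Qed.

Lemma dotvZr k u w : dotv u (k *: w) = k * dotv u w.
Proof. by rewrite dotvC dotvZl dotvC. Qed.

Lemma dotvNl u w : dotv (- u) w = - dotv u w.
Proof. by rewrite -scaleN1r dotvZl mulN1r. Qed.

Lemma dotvNr u w : dotv u (- w) = - dotv u w.
Proof. by rewrite dotvC dotvNl dotvC. Qed.

Lemma dotv0l u : dotv 0 u = 0.
Proof. by rewrite -(scale0r 0) dotvZl mul0r. Qed.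

Lemma dotv0r u : dotv u 0 = 0.
Proof. by rewrite dotvC dotv0l. Qed.

Definition dotvE := (dotvDl, dotvDr, dotvNl, dotvNr, dotvZl, dotvZr).

Lemma dotvv_eq0 u : (dotv u u == 0) = (u == 0).
Proof.
apply/idP/eqP => [|->]; last by rewrite dotv0l.
rewrite psumr_eq0 => [/allP u0|i _]; last by rewrite -expr2 sqr_ge0.
apply/rowP => i; rewrite mxE; apply/eqP.
by have := u0 i (mem_index_enum i); rewrite mulf_eq0 orbb.
Qed.

(** Registered as a bilinear instance so that the general product rule for bilinear maps applies to
    inner products of vector-valued maps. *)
Lemma dotv_is_bilinear :
  bilinear_for
    (GRing.Scale.Law.clone _ _ *:%R _) (GRing.Scale.Law.clone _ _ *:%R _)
    (@dotv R n).
Proof. by split=> u a v w /=; rewrite ?(dotvDl, dotvZl) ?(dotvDr, dotvZr). Qed.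

HB.instance Definition _ := bilinear_isBilinear.Build R 'rV[R]_n 'rV[R]_n R _ _
  (@dotv R n) dotv_is_bilinear.

Lemma dotv_continuous : continuous (fun p : 'rV[R]_n * 'rV[R]_n => dotv p.1 p.2).
Proof.
move=> p; rewrite /dotv /continuous_at.
elim: (index_enum _) => [|i s IH].
  by under eq_fun do rewrite big_nil; rewrite big_nil; exact: cvg_cst.
under eq_fun do rewrite big_cons.
rewrite big_cons; apply: cvgD IH; apply: cvgM.
  exact: (continuous_comp (f := fst) cvg_fst (@coord_continuous _ _ _ _ _ _)).
exact: (continuous_comp (f := snd) cvg_snd (@coord_continuous _ _ _ _ _ _)).
Qed.

End DotProduct.

(** * Calculus of smooth maps on an open set *)

Section SmoothMaps.
Context {R : realType}.
Implicit Types V W : normedModType R.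

Lemma near_open V (U : set V) (P : V -> Prop) x :
  open U -> U x -> (forall y, U y -> P y) -> \forall y \near x, P y.
Proof.
move=> oU Ux UP; have : nbhs x U by exact: open_nbhs_nbhs.
by apply: filterS.
Qed.

(** The continuous linear map ['d f x] satisfies the first-order expansion of [g] too, because the
    two maps agree near [x]; uniqueness of the differential then identifies it with ['d g x]. *)
Lemma near_eq_differentiable V W (f g : V -> W) x :
  (\near x, f x = g x) -> differentiable f x -> differentiable g x.
Proof.
move=> fg df.
have fgx : f x = g x := nbhs_singleton fg.
have cdf : continuous ('d f x : V -> W) by exact: diff_continuous.
have gE : g \o shift x = cst (g x) + 'd f x +o_ (0 : V) id.
  apply/eqaddoP => e e0.
  have := diff_locally df; move=> /eqaddoP /(_ e e0).
  have : \forall y \near (0 : V), f (y + x) = g (y + x).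
    by move: fg; rewrite (near_shift 0) subr0.
  by apply: filterS2 => y fgy; rewrite !fctE /= fgy fgx.
by apply/diff_locallyP; rewrite (diff_unique cdf gE).
Qed.


(** Derivatives at a point of the open set [U] depend only on nearby values, so agreement on [U]
    passes to derivatives of every order. *)
Lemma Ck_on_ext V W k (U : set V) (f g : V -> W) :
  open U -> (forall x, U x -> f x = g x) -> Ck_on k U f -> Ck_on k U g.
Proof.
move=> oU; elim: k f g => [|k IH] f g fg /=.
  move=> cf x Ux; rewrite /prop_for /continuous_at -fg//.
  apply: cvg_trans (cf x Ux); apply: near_eq_cvg.
  exact: near_open Ux fg.
move=> [df Df]; split=> [x Ux|v].
  by apply: near_eq_differentiable (df x Ux); exact: near_open Ux fg.
apply: IH (Df v) => x Ux; apply: near_eq_derive.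
exact: near_open Ux fg.
Qed.

Lemma Ck_on_pred V W k (U : set V) (f : V -> W) : Ck_on k.+1 U f -> Ck_on k U f.
Proof.
elim: k f => [|k IH] f [df Df].
  by move=> x /df; exact: differentiable_continuous.
by split=> // v; apply: IH.
Qed.

Lemma Ck_on_cst V W k (U : set V) (a : W) : Ck_on k U (fun _ => a).
Proof.
elim: k a => [|k IH] a /=; first by move=> x _; exact: cst_continuous.
split=> [x _|v]; first exact: differentiable_cst.
rewrite (_ : 'D_v _ = fun _ => 0) //.
by apply/funext => x; exact: derive_cst.
Qed.

Lemma Ck_onD V W k (U : set V) (f g : V -> W) : open U ->
  Ck_on k U f -> Ck_on k U g -> Ck_on k U (fun x => f x + g x).
Proof.
move=> oU; elim: k f g => [|k IH] f g.
  by move=> cf cg x Ux; apply: cvgD; [exact: cf|exact: cg].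
move=> [df Df] [dg Dg]; split=> [x Ux|v].
  by apply: differentiableD; [exact: df|exact: dg].
apply: Ck_on_ext (IH _ _ (Df v) (Dg v)) => // x Ux.
by rewrite [RHS]deriveD//; apply: diff_derivable; [exact: df|exact: dg].
Qed.

Section Bilinear.
Context {V W1 W2 W : normedModType R} (B : {bilinear W1 -> W2 -> W}).
Hypothesis cB : continuous (fun p => B p.1 p.2).
Implicit Types (f : V -> W1) (g : V -> W2).

Lemma differentiable_bilinear f g x : differentiable f x -> differentiable g x ->
  differentiable (fun y => B (f y) (g y)) x.
Proof.
move=> df dg.
apply: (@differentiable_comp _ _ _ _ (fun y => (f y, g y)) (fun p => B p.1 p.2)).
  exact: differentiable_pair.
exact: differentiable_bilin.
Qed.

Lemma derive_bilinear f g x v : differentiable f x -> differentiable g x ->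
  'D_v (fun y => B (f y) (g y)) x = B ('D_v f x) (g x) + B (f x) ('D_v g x).
Proof.
move=> df dg; rewrite deriveE; last exact: differentiable_bilinear.
rewrite (diff_comp (f := fun y => (f y, g y)) (g := fun p => B p.1 p.2)).
- by rewrite /= diff_bilin// diff_pair//= !deriveE// addrC.
- exact: differentiable_pair.
- exact: differentiable_bilin.
Qed.

(** Induction on [k]: the product rule writes each directional derivative as a sum of two terms of
    the same shape, one order lower. Products, scalings and inner products are all instances. *)
Lemma Ck_on_bilinear k (U : set V) f g : open U ->
  Ck_on k U f -> Ck_on k U g -> Ck_on k U (fun x => B (f x) (g x)).
Proof.
move=> oU; elim: k f g => [|k IH] f g.
  move=> cf cg x Ux.
  rewrite /prop_for /continuous_at.
  have cBx : B z.1 z.2 @[z --> (f x, g x)] --> B (f x) (g x) 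
    by exact: (@cB (f x, g x)).
  by apply: (continuous2_cvg _ cBx); [exact: cf|exact: cg].
move=> Cf Cg; have [df Df] := Cf; have [dg Dg] := Cg; split=> [x Ux|v].
  by apply: differentiable_bilinear; [exact: df|exact: dg].
have := Ck_onD oU (IH _ _ (Df v) (Ck_on_pred Cg)) (IH _ _ (Ck_on_pred Cf) (Dg v)).
by apply: Ck_on_ext => // x Ux; rewrite derive_bilinear; [|exact: df|exact: dg].
Qed.

End Bilinear.


(** The derivative of [1/f] is [- f^-2 'D_v f], in which [1/f] is already of class C^k by
    induction. *)
Lemma Ck_onV V k (U : set V) (f : V -> R) : open U ->
  (forall x, U x -> f x != 0) -> Ck_on k U f -> Ck_on k U (fun x => (f x)^-1).
Proof.
move=> oU f0; elim: k => [|k IH] Cf.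
  by move=> x Ux; apply: cvgV; [exact: f0|exact: Cf].
have [df Df] := Cf; split=> [x Ux|v].
  by apply: differentiableV; [exact: df|exact: f0].
have Cfi := IH (Ck_on_pred Cf).
have := Ck_on_bilinear (B := *%R) (@mul_continuous _) oU
  (Ck_on_bilinear (B := *%R) (@mul_continuous _) oU Cfi Cfi)
  (Ck_on_bilinear (B := *%R) (@mul_continuous _) oU (@Ck_on_cst V R k U (-1)) (Df v)).
apply: Ck_on_ext => // x Ux; rewrite deriveV ?f0//.
  by rewrite /= mulN1r mulrN scaleNr expr2 invfM.
by apply: diff_derivable; exact: df.
Qed.

Lemma scale_is_bilinear V :
  bilinear_for
    (GRing.Scale.Law.clone _ _ *:%R _) (GRing.Scale.Law.clone _ _ *:%R _)
    (@GRing.scale R V).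
Proof.
split=> [u a s t|s a u v] /=; first by rewrite scalerDl -scalerA.
by rewrite scalerDr !scalerA mulrC.
Qed.
HB.instance Definition _ V := bilinear_isBilinear.Build R R V V _ _
  (@GRing.scale R V) (@scale_is_bilinear V).

Section Smooth.
Context {V : normedModType R} (U : set V).
Hypothesis oU : open U.

Lemma smooth_on_differentiable W (f : V -> W) x :
  smooth_on U f -> U x -> differentiable f x.
Proof. by move=> /(_ 1) [+ _]; exact. Qed.

Lemma smooth_on_ext W (f g : V -> W) :
  (forall x, U x -> f x = g x) -> smooth_on U f -> smooth_on U g.
Proof. by move=> fg sf k; exact: Ck_on_ext fg (sf k). Qed.

Lemma smooth_on_cst W (a : W) : smooth_on U (fun _ => a).
Proof. by move=> k; exact: Ck_on_cst. Qed.

Lemma smooth_onD W (f g : V -> W) :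
  smooth_on U f -> smooth_on U g -> smooth_on U (fun x => f x + g x).
Proof. by move=> sf sg k; exact: Ck_onD. Qed.

Lemma smooth_onZ W (s : V -> R) (f : V -> W) :
  smooth_on U s -> smooth_on U f -> smooth_on U (fun x => s x *: f x).
Proof.
move=> ss sf k; apply: (Ck_on_bilinear (B := *:%R)) => //.
exact: scale_continuous.
Qed.

Lemma smooth_onM (s t : V -> R) :
  smooth_on U s -> smooth_on U t -> smooth_on U (fun x => s x * t x).
Proof. exact: smooth_onZ. Qed.

Lemma smooth_onN W (f : V -> W) : smooth_on U f -> smooth_on U (fun x => - f x).
Proof.
move=> sf; have := smooth_onZ (smooth_on_cst (-1 : R)) sf.
by apply: smooth_on_ext => x _; rewrite scaleN1r.
Qed.

Lemma smooth_onB W (f g : V -> W) :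
  smooth_on U f -> smooth_on U g -> smooth_on U (fun x => f x - g x).
Proof. by move=> sf sg; apply: smooth_onD => //; exact: smooth_onN. Qed.

Lemma smooth_on_dotv n (f g : V -> 'rV[R]_n) :
  smooth_on U f -> smooth_on U g -> smooth_on U (fun x => dotv (f x) (g x)).
Proof.
move=> sf sg k; apply: (Ck_on_bilinear (B := @dotv R n)) => //.
exact: dotv_continuous.
Qed.

Lemma smooth_onV (f : V -> R) : (forall x, U x -> f x != 0) ->
  smooth_on U f -> smooth_on U (fun x => (f x)^-1).
Proof. by move=> f0 sf k; exact: Ck_onV. Qed.

Lemma smooth_on_derive W (f : V -> W) v : smooth_on U f -> smooth_on U ('D_v f).
Proof. by move=> sf k; have [_] := sf k.+1; exact. Qed.

End Smooth.

Lemma derive_dotv V n (f g : V -> 'rV[R]_n) x v :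
  differentiable f x -> differentiable g x ->
  'D_v (fun y => dotv (f y) (g y)) x = dotv ('D_v f x) (g x) + dotv (f x) ('D_v g x).
Proof. exact: (derive_bilinear (B := @dotv R n) dotv_continuous). Qed.

Lemma derive_scale V W (s : V -> R) (f : V -> W) x v :
  differentiable s x -> differentiable f x ->
  'D_v (fun y => s y *: f y) x = 'D_v s x *: f x + s x *: 'D_v f x.
Proof. exact: (derive_bilinear (B := *:%R) scale_continuous). Qed.

End SmoothMaps.

(** * Symmetry of second derivatives *)

Section Schwarz.
Context {R : realType} {V : normedModType R}.
Implicit Types (f : V -> R) (a v w x : V).

Lemma is_derive_line f a v (t : R) : differentiable f (a + t *: v) ->
  is_derive t 1 (fun s : R => f (a + s *: v)) ('D_v f (a + t *: v)).
Proof.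
move=> df; have dl : is_diff t (fun s : R => a + s *: v) ( *:%R^~ v).
  by apply: is_diff_eq; apply/funext => s /=; rewrite add0r.
have dfl : differentiable (fun s : R => f (a + s *: v)) t.
  exact: (@differentiable_comp _ _ _ _ (fun s : R => a + s *: v) f).
apply: DeriveDef; first exact: diff_derivable.
rewrite !deriveE// (@diff_comp _ _ _ _ (fun s : R => a + s *: v) f)//=.
by rewrite diff_val scale1r.
Qed.

Lemma mean_value_line f a v (s : R) : 0 < s ->
  (forall t, 0 <= t <= s -> differentiable f (a + t *: v)) ->
  exists2 t, 0 <= t <= s & f (a + s *: v) - f a = 'D_v f (a + t *: v) * s.
Proof.
move=> s0 df.
have [|||t] := @MVT R (fun t => f (a + t *: v)) (fun t => 'D_v f (a + t *: v)) 0 s.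
- by [].
- move=> t; rewrite in_itv/= => /andP[t0 ts].
  by apply: is_derive_line; apply: df; rewrite !ltW.
- apply: derivable_within_continuous => t; rewrite in_itv/= => ts.
  by apply: ex_derive; apply: is_derive_line; exact: df.
rewrite in_itv/= => /andP[t0 ts] E; exists t; first by rewrite !ltW.
by move: E; rewrite scale0r addr0 subr0.
Qed.

(** The mean value theorem is used twice: along [v] for the difference [g y = f (y + s *: w) - f y],
    then along [w] for ['D_v f]. *)
Lemma second_difference f x v w (s : R) : 0 < s ->
  (forall t r, 0 <= t <= s -> 0 <= r <= s ->
     differentiable f (x + t *: v + r *: w) /\
     differentiable ('D_v f) (x + t *: v + r *: w)) ->
  exists t r, [/\ 0 <= t <= s, 0 <= r <= s &
    f (x + s *: v + s *: w) - f (x + s *: v) - (f (x + s *: w) - f x) =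
    'D_w ('D_v f) (x + t *: v + r *: w) * s * s].
Proof.
move=> s0 df.
pose g y := f (y + s *: w) - f y.
have dg t : 0 <= t <= s -> differentiable g (x + t *: v) /\
    'D_v g (x + t *: v) = 'D_v f (x + t *: v + s *: w) - 'D_v f (x + t *: v).
  move=> ts; have ss : 0 <= s <= s by rewrite ltW/=.
  have s00 : (0 : R) <= 0 <= s by rewrite lexx ltW.
  have [d1 _] := df t s ts ss; have [d2 _] := df t 0 ts s00.
  rewrite scale0r addr0 in d2.
  have dl : is_diff (x + t *: v) (fun y => y + s *: w) id.
    by apply: is_diff_eq; apply/funext => y /=; rewrite addr0.
  have d3 : differentiable (fun y => f (y + s *: w)) (x + t *: v).
    exact: (@differentiable_comp _ _ _ _ (fun y => y + s *: w) f).
  split; first exact: differentiableB.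
  rewrite /g deriveB; [|exact: diff_derivable..].
  congr (_ - _); rewrite !deriveE//.
  by rewrite (@diff_comp _ _ _ _ (fun y => y + s *: w) f)//= diff_val.
have [t ts E] := mean_value_line s0 (fun t ts => (dg t ts).1).
have [r rs E'] := mean_value_line s0 (fun r rs => (df t r ts rs).2).
exists t, r; split => //.
by rewrite -E' -(dg t ts).2 -E /g.
Qed.

(** The second difference over a parallelogram is symmetric in [v] and [w], so the two mixed
    derivatives share a value at points arbitrarily close to [x]. If they differed by [D > 0] in
    absolute value at [x], continuity would keep both within [D / 2] of their values there, giving
    [D < D]. *)
Lemma derive_comm_real (U : set V) f x v w : open U -> U x ->
  smooth_on U f -> 'D_v ('D_w f) x = 'D_w ('D_v f) x.
Proof.
move=> oU Ux sf.
have sv := smooth_on_derive v sf; have sw := smooth_on_derive w sf.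
have cvw : {for x, continuous ('D_v ('D_w f))}.
  exact: (smooth_on_derive v sw 0).
have cwv : {for x, continuous ('D_w ('D_v f))}.
  exact: (smooth_on_derive w sv 0).
apply/eqP; rewrite -subr_eq0 -normr_eq0; apply: contraT => D0.
have [D DE] : exists D, D = `|'D_v ('D_w f) x - 'D_w ('D_v f) x| by eexists.
rewrite -DE in D0; have {}D0 : 0 < D by rewrite lt_neqAle eq_sym D0 DE normr_ge0.
have D2 : 0 < D / 2 by rewrite divr_gt0.
have : \forall y \near x, [/\ U y,
     `|'D_v ('D_w f) x - 'D_v ('D_w f) y| < D / 2 &
     `|'D_w ('D_v f) x - 'D_w ('D_v f) y| < D / 2].
  have nU : nbhs x U by exact: open_nbhs_nbhs.
  have nvw : \forall y \near x, `|'D_v ('D_w f) x - 'D_v ('D_w f) y| < D / 2.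
    by move/cvgrPdist_lt: cvw; apply.
  have nwv : \forall y \near x, `|'D_w ('D_v f) x - 'D_w ('D_v f) y| < D / 2.
    by move/cvgrPdist_lt: cwv; apply.
  exact: filterS3 nU nvw nwv.
move=> /nbhs_normP[e /= e0 He].
(* This size keeps the whole parallelogram with sides [s *: v] and [s *: w] in the ball of radius
   [e]; the summand 1 makes the denominator positive even if [v = w = 0]. *)
pose s := e / 2 / (`|v| + `|w| + 1).
have vw0 : 0 < `|v| + `|w| + 1 by rewrite ltr_wpDl// addr_ge0.
have s0 : 0 < s by rewrite !divr_gt0.
have Hs t r : 0 <= t <= s -> 0 <= r <= s -> `|t *: v + r *: w| < e.
  move=> /andP[t0 ts] /andP[r0 rs].
  rewrite (le_lt_trans (ler_normD _ _))// !normrZ !ger0_norm//.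
  apply: (@le_lt_trans _ _ (s * (`|v| + `|w| + 1))).
    rewrite mulrDr mulr1 mulrDr -[leLHS]addr0.
    by rewrite lerD ?(ltW s0)// lerD// ler_wpM2r.
  by rewrite divfK ?gt_eqF// gtr_pMr// invf_lt1// ltr1n.
have Hvw t r : 0 <= t <= s -> 0 <= r <= s -> `|x - (x + t *: v + r *: w)| < e.
  by move=> ts rs; rewrite -addrA opprD addNKr normrN Hs.
have Hwv t r : 0 <= t <= s -> 0 <= r <= s -> `|x - (x + t *: w + r *: v)| < e.
  by move=> ts rs; rewrite -addrA [_ *: w + _]addrC addrA Hvw.
clearbody s; have [t [r [ts rs E]]] : exists t r, [/\ 0 <= t <= s, 0 <= r <= s &
    f (x + s *: v + s *: w) - f (x + s *: v) - (f (x + s *: w) - f x) =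
    'D_w ('D_v f) (x + t *: v + r *: w) * s * s].
  apply: second_difference => // t r ts rs.
  have [Uy _ _] := He _ (Hvw t r ts rs).
  by split; [exact: smooth_on_differentiable sf Uy|
             exact: smooth_on_differentiable sv Uy].
have [t' [r' [ts' rs' E']]] : exists t r, [/\ 0 <= t <= s, 0 <= r <= s &
    f (x + s *: w + s *: v) - f (x + s *: w) - (f (x + s *: v) - f x) =
    'D_v ('D_w f) (x + t *: w + r *: v) * s * s].
  apply: second_difference => // t' r' ts' rs'.
  have [Uy _ _] := He _ (Hwv t' r' ts' rs').
  by split; [exact: smooth_on_differentiable sf Uy|
             exact: smooth_on_differentiable sw Uy].
have [_ _ Bwv] := He _ (Hvw t r ts rs).
have [_ Bvw _] := He _ (Hwv t' r' ts' rs').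
(* Both sides multiplied by [s * s] equal the same second difference. *)
have EE : 'D_w ('D_v f) (x + t *: v + r *: w) = 'D_v ('D_w f) (x + t' *: w + r' *: v).
  apply: (mulIf (lt0r_neq0 s0)); apply: (mulIf (lt0r_neq0 s0)).
  apply: (etrans (esym E)); apply: (etrans _ E').
  by rewrite (addrAC x) !opprB addrACA [RHS]addrACA; congr (_ + _); rewrite addrC.
rewrite -EE in Bvw.
suff : D < D by rewrite ltxx.
rewrite {1}DE [ltRHS]splitr; apply: le_lt_trans (ltrD Bvw Bwv).
rewrite [X in _ <= _ + X]distrC; apply: le_trans (ler_normD _ _).
by rewrite subrKA.
Qed.

End Schwarz.

Lemma derive_dotvr (R : realType) (V : normedModType R) n (f : V -> 'rV[R]_n)
    (a : 'rV[R]_n) x v :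
  differentiable f x -> 'D_v (fun y => dotv (f y) a) x = dotv ('D_v f x) a.
Proof.
by move=> df; rewrite derive_dotv// derive_cst dotv0r addr0.
Qed.

Lemma dotv_inj (R : realType) n (a b : 'rV[R]_n) :
  (forall c, dotv a c = dotv b c) -> a = b.
Proof.
move=> ab; apply/eqP; rewrite -subr_eq0 -dotvv_eq0 dotvDl dotvNl ab.
by rewrite subrr.
Qed.

(** The scalar case applied to the inner product of [f] with each constant vector. *)
Lemma derive_comm (R : realType) (V : normedModType R) n (U : set V)
    (f : V -> 'rV[R]_n) x v w : open U -> U x ->
  smooth_on U f -> 'D_v ('D_w f) x = 'D_w ('D_v f) x.
Proof.
move=> oU Ux sf; apply: dotv_inj => c.
have dE (g : V -> 'rV[R]_n) u y : smooth_on U g -> U y ->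
    'D_u (fun y => dotv (g y) c) y = dotv ('D_u g y) c.
  by move=> sg Uy; rewrite derive_dotvr//; exact: smooth_on_differentiable Uy.
have dEE u u' : dotv ('D_u ('D_u' f) x) c = 'D_u ('D_u' (fun y => dotv (f y) c)) x.
  rewrite -dE//; last exact: smooth_on_derive.
  apply: near_eq_derive; apply: near_open oU Ux _ => y Uy.
  by rewrite dE.
apply: etrans (dEE v w) (etrans _ (esym (dEE w v))).
apply: (derive_comm_real _ _ oU Ux).
exact: (smooth_on_dotv oU sf (@smooth_on_cst _ _ U _ c)).
Qed.

(** * Orthogonal projection onto the plane spanned by two vectors *)

Section Planes.
Context {R : realType} {n : nat}.
Implicit Types a b u v w : 'rV[R]_n.

Definition gram a b : R := dotv a a * dotv b b - dotv a b ^+ 2.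

(** [coefl] and [coefr] solve, by Cramer's rule, the normal equations for the orthogonal projection
    of [v] onto the span of [a] and [b]. *)
Definition coefl a b v : R :=
  (dotv b b * dotv v a - dotv a b * dotv v b) / gram a b.

Definition coefr a b v : R :=
  (dotv a a * dotv v b - dotv a b * dotv v a) / gram a b.

Definition plane_proj a b v := coefl a b v *: a + coefr a b v *: b.

Definition plane_perp a b v := v - plane_proj a b v.

(** The vector [- (a . b) a + (a . a) b] has squared norm [(a . a) gram a b]; a vanishing Gram
    determinant would thus give a nontrivial linear relation. *)
Lemma gram_neq0 a b :
  (forall s t : R, s *: a + t *: b = 0 -> s = 0 /\ t = 0) -> gram a b != 0.
Proof.
move=> ab; apply/eqP => G0.
have a0 : dotv a a != 0.
  rewrite dotvv_eq0; apply/eqP => a0.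
  have [|/eqP] := ab 1 0; first by rewrite a0 scaler0 scale0r addr0.
  by rewrite oner_eq0.
have /ab[_ /eqP] : (- dotv a b) *: a + dotv a a *: b = 0.
  apply/eqP; rewrite -dotvv_eq0 !dotvE; apply/eqP.
  rewrite (dotvC b a); transitivity (dotv a a * gram a b); last by rewrite G0 mulr0.
  by rewrite /gram; ring.
by rewrite (negPf a0).
Qed.

Section Independent.
Variables (a b : 'rV[R]_n).
Hypothesis ab0 : gram a b != 0.

Lemma projP v : dotv (plane_proj a b v) a = dotv v a /\ dotv (plane_proj a b v) b = dotv v b.
Proof.
have := ab0; rewrite /plane_proj /coefl /coefr !dotvE (dotvC b a) /gram => ab0'.
by split; field.
Qed.

Lemma coef_comb s t :
  coefl a b (s *: a + t *: b) = s /\ coefr a b (s *: a + t *: b) = t.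
Proof.
have := ab0; rewrite /coefl /coefr !dotvE (dotvC b a) /gram => ab0'.
by split; field.
Qed.

Lemma comb_inj s t s' t' : s *: a + t *: b = s' *: a + t' *: b -> s = s' /\ t = t'.
Proof.
move=> E; have [sE tE] := coef_comb s t; have [s'E t'E] := coef_comb s' t'.
by split; [rewrite -sE E s'E|rewrite -tE E t'E].
Qed.

Lemma proj_comb s t : plane_proj a b (s *: a + t *: b) = s *: a + t *: b.
Proof. by rewrite {1}/plane_proj; have [-> ->] := coef_comb s t. Qed.

Lemma proj_is_linear : linear (plane_proj a b).
Proof.
move=> k u v; rewrite /plane_proj scalerDr !scalerA addrACA -!scalerDl.
by congr (_ *: _ + _ *: _); rewrite /coefl /coefr !dotvE; field.
Qed.

Lemma projD u v : plane_proj a b (u + v) = plane_proj a b u + plane_proj a b v.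
Proof. by have := proj_is_linear 1 u v; rewrite !scale1r. Qed.

Lemma projZ k v : plane_proj a b (k *: v) = k *: plane_proj a b v.
Proof.
have p0 : plane_proj a b 0 = 0 by have := proj_comb 0 0; rewrite !scale0r addr0.
by have := proj_is_linear k v 0; rewrite !addr0 p0 addr0.
Qed.

Lemma projN v : plane_proj a b (- v) = - plane_proj a b v.
Proof. by rewrite -scaleN1r projZ scaleN1r. Qed.

Lemma perpD u v : plane_perp a b (u + v) = plane_perp a b u + plane_perp a b v.
Proof. by rewrite /plane_perp projD opprD addrACA. Qed.

Lemma perpZ k v : plane_perp a b (k *: v) = k *: plane_perp a b v.
Proof. by rewrite /plane_perp projZ scalerBr. Qed.

Lemma perp_comb s t : plane_perp a b (s *: a + t *: b) = 0.
Proof. by rewrite /plane_perp proj_comb subrr. Qed.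

Lemma perpl : plane_perp a b a = 0.
Proof. by have := perp_comb 1 0; rewrite scale1r scale0r addr0. Qed.

Lemma perpr : plane_perp a b b = 0.
Proof. by have := perp_comb 0 1; rewrite scale1r scale0r add0r. Qed.

Lemma perpP v : dotv (plane_perp a b v) a = 0 /\ dotv (plane_perp a b v) b = 0.
Proof.
have [pa pb] := projP v.
by split; rewrite /plane_perp dotvDl dotvNl ?pa ?pb subrr.
Qed.

Lemma dotv_perp u v : dotv (plane_perp a b u) (plane_perp a b v) = dotv (plane_perp a b u) v.
Proof.
have [pa pb] := perpP u.
by rewrite {2}/plane_perp dotvDr dotvNr /plane_proj dotvDr !dotvZr pa pb !mulr0 addr0 subr0.
Qed.

Lemma dotv_perp_orth u v :
  dotv v a = 0 -> dotv v b = 0 -> dotv (plane_perp a b u) v = dotv u v.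
Proof.
move=> va vb; rewrite /plane_perp dotvDl dotvNl /plane_proj dotvDl !dotvZl.
by rewrite (dotvC a) (dotvC b) va vb !mulr0 addr0 subr0.
Qed.

Lemma comb_eq0 v : plane_proj a b v = v -> dotv v a = 0 -> dotv v b = 0 -> v = 0.
Proof.
move=> pv va vb; rewrite -pv /plane_proj /coefl /coefr va vb !mulr0 subr0 mul0r.
by rewrite !scale0r addr0.
Qed.

End Independent.

End Planes.

(** Two mutually orthogonal planes in dimension 4 span everything: the matrix with rows [a], [b],
    [c], [d] is invertible, and its transpose annihilates [v]. *)
Lemma dim4_orth_eq0 (R : realType) (a b c d v : 'rV[R]_4) :
  gram a b != 0 -> gram c d != 0 ->
  dotv a c = 0 -> dotv a d = 0 -> dotv b c = 0 -> dotv b d = 0 ->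
  dotv v a = 0 -> dotv v b = 0 -> dotv v c = 0 -> dotv v d = 0 -> v = 0.
Proof.
move=> ab0 cd0 ac ad bc bd va vb vc vd.
pose A : 'M[R]_(1 + (1 + (1 + 1)), 4) := col_mx a (col_mx b (col_mx c d)).
have dotE (u w : 'rV[R]_4) : u *m w^T = (dotv u w)%:M.
  rewrite [LHS]mx11_scalar mxE; congr (_%:M); apply: eq_bigr => i _.
  by rewrite mxE.
have AU : A \in unitmx.
  rewrite -row_free_unit; apply/inj_row_free => w.
  rewrite -[w]hsubmxK -[rsubmx w]hsubmxK -[rsubmx (rsubmx w)]hsubmxK.
  move: (lsubmx w) (lsubmx (rsubmx w)) (lsubmx (rsubmx (rsubmx w)))
    (rsubmx (rsubmx (rsubmx w))) => p q r s.
  rewrite /A !mul_row_col [p]mx11_scalar [q]mx11_scalar [r]mx11_scalar [s]mx11_scalar.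
  rewrite !mul_scalar_mx; move: (p 0 0) (q 0 0) (r 0 0) (s 0 0) => {}p {}q {}r {}s E.
  have dE u : dotv (p *: a + (q *: b + (r *: c + s *: d))) u = 0.
    by rewrite E dotv0l.
  (* Pairing the relation with [a] and [b] removes the part in [c] and [d], so the part in the first
     plane is orthogonal to that plane and vanishes. *)
  have [p0 q0] : p = 0 /\ q = 0.
    apply: (comb_inj ab0); rewrite !scale0r addr0; apply: (comb_eq0 (a := a) (b := b)).
    - exact: proj_comb.
    - by have := dE a; rewrite !dotvE (dotvC c) (dotvC d) ac ad; lra.
    - by have := dE b; rewrite !dotvE (dotvC c) (dotvC d) bc bd; lra.
  have [r0 s0] : r = 0 /\ s = 0.
    apply: (comb_inj cd0); rewrite !scale0r addr0; apply: (comb_eq0 (a := c) (b := d)).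
    - exact: proj_comb.
    - by have := dE c; rewrite !dotvE ac bc; lra.
    - by have := dE d; rewrite !dotvE ad bd; lra.
  by rewrite p0 q0 r0 s0 !raddf0 !row_mx0.
have : v *m A^T = 0.
  rewrite /A !tr_col_mx !mul_mx_row !dotE va vb vc vd.
  by rewrite !raddf0 !row_mx0.
move/(congr1 (mulmx^~ (invmx A^T))); rewrite mulmxK ?unitmx_tr//.
by rewrite mul0mx.
Qed.

(** * Partial derivatives in the plane and smoothness of projections *)

(* Locked: otherwise failed unifications of two derivatives unfold their limits. *)
HB.lock
Definition pder (R : realType) (W : normedModType R) (i : 'I_2)
  (f : 'rV[R]_2 -> W) (u : 'rV[R]_2) : W := 'D_(delta_mx ord0 i) f u.

Local Notation d1 := (pder ord0).
Local Notation d2 := (pder ord_max).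

Lemma ord2P (i : 'I_2) : i = ord0 \/ i = ord_max.
Proof. by case: i => [[|[|//]]] lt2; [left|right]; apply/val_inj. Qed.

Section PartialDerivatives.
Context {R : realType} (U : set 'rV[R]_2).
Hypothesis oU : open U.
Implicit Types (W : normedModType R) (u w : 'rV[R]_2) (i j : 'I_2).

Lemma derive_pder W (f : 'rV[R]_2 -> W) u w : differentiable f u ->
  'D_w f u = w ord0 ord0 *: d1 f u + w ord0 ord_max *: d2 f u.
Proof.
move=> df; rewrite pder.unlock !deriveE// -!linearZ -linearD; congr ('d f u _).
by rewrite [LHS]row_sum_delta big_ord_recl big_ord1; congr (_ + _ *: delta_mx _ _);
  [congr (w _ _)|]; apply/val_inj.
Qed.

Lemma smooth_on_pder W (f : 'rV[R]_2 -> W) i : smooth_on U f -> smooth_on U (pder i f).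
Proof. by rewrite pder.unlock; exact: smooth_on_derive. Qed.

Lemma pder_ext W (f g : 'rV[R]_2 -> W) u i :
  (forall y, U y -> f y = g y) -> U u -> pder i f u = pder i g u.
Proof.
move=> fg Uu; rewrite pder.unlock; apply: near_eq_derive.
exact: near_open fg.
Qed.

Lemma pder_cst W (a : W) u i : pder i (fun _ => a) u = 0.
Proof. by rewrite pder.unlock derive_cst. Qed.

Lemma pderD W (f g : 'rV[R]_2 -> W) u i : smooth_on U f -> smooth_on U g -> U u ->
  pder i (fun y => f y + g y) u = pder i f u + pder i g u.
Proof.
move=> sf sg Uu; rewrite pder.unlock [LHS]deriveD//; apply: diff_derivable.
  exact: smooth_on_differentiable sf Uu.
exact: smooth_on_differentiable sg Uu.
Qed.

Lemma pderB W (f g : 'rV[R]_2 -> W) u i : smooth_on U f -> smooth_on U g -> U u ->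
  pder i (fun y => f y - g y) u = pder i f u - pder i g u.
Proof.
move=> sf sg Uu; rewrite pder.unlock [LHS]deriveB//; apply: diff_derivable.
  exact: smooth_on_differentiable sf Uu.
exact: smooth_on_differentiable sg Uu.
Qed.

Lemma pderZ W (s : 'rV[R]_2 -> R) (f : 'rV[R]_2 -> W) u i :
  smooth_on U s -> smooth_on U f -> U u ->
  pder i (fun y => s y *: f y) u = pder i s u *: f u + s u *: pder i f u.
Proof.
move=> ss sf Uu; rewrite pder.unlock derive_scale//.
  exact: smooth_on_differentiable ss Uu.
exact: smooth_on_differentiable sf Uu.
Qed.

Lemma pderM (s t : 'rV[R]_2 -> R) u i :
  smooth_on U s -> smooth_on U t -> U u ->
  pder i (fun y => s y * t y) u = pder i s u * t u + s u * pder i t u.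
Proof. exact: pderZ. Qed.

Lemma pder_dotv n (f g : 'rV[R]_2 -> 'rV[R]_n) u i :
  smooth_on U f -> smooth_on U g -> U u ->
  pder i (fun y => dotv (f y) (g y)) u =
  dotv (pder i f u) (g u) + dotv (f u) (pder i g u).
Proof.
move=> sf sg Uu; rewrite pder.unlock derive_dotv//.
  exact: smooth_on_differentiable sf Uu.
exact: smooth_on_differentiable sg Uu.
Qed.

Lemma pderC n (f : 'rV[R]_2 -> 'rV[R]_n) u i j :
  smooth_on U f -> U u -> pder i (pder j f) u = pder j (pder i f) u.
Proof.
move=> sf Uu; rewrite pder.unlock; exact: (derive_comm _ _ oU Uu sf).
Qed.

Lemma pder_comb n (s t : 'rV[R]_2 -> R) (f g : 'rV[R]_2 -> 'rV[R]_n) u i :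
  smooth_on U s -> smooth_on U t -> smooth_on U f -> smooth_on U g -> U u ->
  pder i (fun y => s y *: f y + t y *: g y) u =
  pder i s u *: f u + s u *: pder i f u + (pder i t u *: g u + t u *: pder i g u).
Proof.
move=> ss st sf sg Uu; rewrite pderD ?pderZ//; exact: smooth_onZ.
Qed.

Lemma smooth_on_comb n (s t : 'rV[R]_2 -> R) (f g : 'rV[R]_2 -> 'rV[R]_n) :
  smooth_on U s -> smooth_on U t -> smooth_on U f -> smooth_on U g ->
  smooth_on U (fun y => s y *: f y + t y *: g y).
Proof. by move=> ss st sf sg; apply: smooth_onD => //; exact: smooth_onZ. Qed.

Section SmoothProjection.
Context {n : nat} (a b v : 'rV[R]_2 -> 'rV[R]_n).
Hypotheses (sa : smooth_on U a) (sb : smooth_on U b) (sv : smooth_on U v).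
Hypothesis ab0 : forall u, U u -> gram (a u) (b u) != 0.

Lemma smooth_on_gramV : smooth_on U (fun u => (gram (a u) (b u))^-1).
Proof.
apply: smooth_onV => //; apply: smooth_onB => //.
  by apply: smooth_onM => //; exact: smooth_on_dotv.
by apply: smooth_onM => //; exact: smooth_on_dotv.
Qed.

Lemma smooth_on_coefl : smooth_on U (fun u => coefl (a u) (b u) (v u)).
Proof.
apply: smooth_onM => //; last exact: smooth_on_gramV.
by apply: smooth_onB => //; apply: smooth_onM => //; exact: smooth_on_dotv.
Qed.

Lemma smooth_on_coefr : smooth_on U (fun u => coefr (a u) (b u) (v u)).
Proof.
apply: smooth_onM => //; last exact: smooth_on_gramV.
by apply: smooth_onB => //; apply: smooth_onM => //; exact: smooth_on_dotv.
Qed.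

Lemma smooth_on_proj : smooth_on U (fun u => plane_proj (a u) (b u) (v u)).
Proof.
by apply: smooth_on_comb => //; [exact: smooth_on_coefl|exact: smooth_on_coefr].
Qed.

Lemma smooth_on_perp : smooth_on U (fun u => plane_perp (a u) (b u) (v u)).
Proof. by apply: smooth_onB => //; exact: smooth_on_proj. Qed.

End SmoothProjection.

End PartialDerivatives.

(** * Parametrized surfaces: second fundamental form and Gauss equation *)

Section LocalSurface.
Context {R : realType} {n : nat} (U : set 'rV[R]_2) (h : 'rV[R]_2 -> 'rV[R]_n).
Hypotheses (oU : open U) (sh : smooth_on U h).
Hypothesis hreg : forall u, U u -> gram (d1 h u) (d2 h u) != 0.

Let sdh i : smooth_on U (pder i h) := smooth_on_pder i sh.

Definition tproj u v := plane_proj (d1 h u) (d2 h u) v.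
Definition sff i j u := plane_perp (d1 h u) (d2 h u) (pder i (pder j h) u).
(* The numerator of the Gaussian curvature, by the Gauss equation. *)
Definition gauss u :=
  dotv (sff ord0 ord0 u) (sff ord_max ord_max u) -
  dotv (sff ord0 ord_max u) (sff ord0 ord_max u).

Lemma sffC i j u : U u -> sff i j u = sff j i u.
Proof. by move=> Uu; rewrite /sff (pderC oU i j sh Uu). Qed.

(* Differentiating (tproj v) . h_k = v . h_k moves the derivative of the
   projection onto the second fundamental form. *)
Lemma dotv_pder_tproj (v : 'rV[R]_2 -> 'rV[R]_n) i k u : smooth_on U v -> U u ->
  dotv (pder i (fun y => tproj y (v y)) u) (pder k h u) =
  dotv (pder i v u) (pder k h u) + dotv (plane_perp (d1 h u) (d2 h u) (v u)) (sff i k u).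
Proof.
move=> sv Uu.
have sN : smooth_on U (fun y => tproj y (v y)) by exact: smooth_on_proj.
have E : pder i (fun y => dotv (tproj y (v y)) (pder k h y)) u =
         pder i (fun y => dotv (v y) (pder k h y)) u.
  apply: (pder_ext oU) => // y Uy.
  have [p1 p2] := projP (hreg Uy) (v y).
  by have [->|->] := ord2P k.
rewrite (pder_dotv i sN (sdh k) Uu) (pder_dotv i sv (sdh k) Uu) in E.
rewrite /sff (dotv_perp (hreg Uu)) /plane_perp dotvDl dotvNl.
apply: (addIr (dotv (tproj u (v u)) (pder i (pder k h) u))).
by rewrite E -[RHS]addrA subrK.
Qed.

(** Derivatives of the coefficients only contribute tangent vectors, which the normal projection
    kills. *)
Lemma perp_pder_comb (s t : 'rV[R]_2 -> R) i u :
  smooth_on U s -> smooth_on U t -> U u ->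
  plane_perp (d1 h u) (d2 h u) (pder i (fun y => s y *: d1 h y + t y *: d2 h y) u) =
  s u *: sff i ord0 u + t u *: sff i ord_max u.
Proof.
move=> ss st Uu; rewrite (pder_comb oU i ss st (sdh _) (sdh _) Uu).
by rewrite !(perpD (hreg Uu), perpZ (hreg Uu)) (perpl (hreg Uu)) (perpr (hreg Uu))
  !scaler0 !add0r.
Qed.

Variables (x1 x2 y1 y2 z1 z2 : 'rV[R]_2 -> R).
Hypotheses (sx1 : smooth_on U x1) (sx2 : smooth_on U x2) (sy1 : smooth_on U y1)
  (sy2 : smooth_on U y2) (sz1 : smooth_on U z1) (sz2 : smooth_on U z2).

Let Z u := z1 u *: d1 h u + z2 u *: d2 h u.

(** The second derivatives of [h] cancel by symmetry, leaving a tangent vector with the usual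
    bracket coordinates. *)
Lemma local_bracket u : U u ->
  x1 u *: d1 (fun y => y1 y *: d1 h y + y2 y *: d2 h y) u +
  x2 u *: d2 (fun y => y1 y *: d1 h y + y2 y *: d2 h y) u -
  (y1 u *: d1 (fun y => x1 y *: d1 h y + x2 y *: d2 h y) u +
   y2 u *: d2 (fun y => x1 y *: d1 h y + x2 y *: d2 h y) u) =
  (x1 u * d1 y1 u + x2 u * d2 y1 u - (y1 u * d1 x1 u + y2 u * d2 x1 u)) *: d1 h u +
  (x1 u * d1 y2 u + x2 u * d2 y2 u - (y1 u * d1 x2 u + y2 u * d2 x2 u)) *: d2 h u.
Proof.
move=> Uu; rewrite !(pder_comb oU _ sx1 sx2 (sdh _) (sdh _) Uu).
rewrite !(pder_comb oU _ sy1 sy2 (sdh _) (sdh _) Uu).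
rewrite (pderC oU ord_max ord0 sh Uu).
by apply/rowP => i; rewrite !mxE; ring.
Qed.

Lemma dotv_pder_nabla (s1 s2 : 'rV[R]_2 -> R) i k u :
  smooth_on U s1 -> smooth_on U s2 -> U u ->
  dotv (pder i (fun y => tproj y (s1 y *: d1 Z y + s2 y *: d2 Z y)) u) (pder k h u) =
  pder i s1 u * dotv (d1 Z u) (pder k h u) + pder i s2 u * dotv (d2 Z u) (pder k h u) +
  s1 u * dotv (pder i (d1 Z) u) (pder k h u) +
  s2 u * dotv (pder i (d2 Z) u) (pder k h u) +
  s1 u * (z1 u * dotv (sff ord0 ord0 u) (sff i k u) +
          z2 u * dotv (sff ord0 ord_max u) (sff i k u)) +
  s2 u * (z1 u * dotv (sff ord0 ord_max u) (sff i k u) +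
          z2 u * dotv (sff ord_max ord_max u) (sff i k u)).
Proof.
move=> ss1 ss2 Uu.
have sZ : smooth_on U Z by exact: smooth_on_comb.
have sdZ j := smooth_on_pder j sZ.
rewrite (dotv_pder_tproj i k (smooth_on_comb oU ss1 ss2 (sdZ _) (sdZ _)) Uu).
rewrite (pder_comb oU i ss1 ss2 (sdZ _) (sdZ _) Uu).
rewrite (perpD (hreg Uu)) !(perpZ (hreg Uu)) !(perp_pder_comb _ sz1 sz2 Uu).
by rewrite (sffC ord_max ord0 Uu) !(dotvDl, dotvZl); ring.
Qed.

Lemma tprojB u v w : U u -> tproj u v - tproj u w = tproj u (v - w).
Proof. by move=> Uu; rewrite /tproj (projD (hreg Uu)) (projN (hreg Uu)). Qed.

Lemma tproj_eq0 u v : U u -> (forall k, dotv v (pder k h u) = 0) -> tproj u v = 0.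
Proof.
move=> Uu v0; rewrite /tproj /plane_proj /coefl /coefr !v0 !mulr0 subr0 mul0r.
by rewrite !scale0r addr0.
Qed.

(** The Gauss equation. Paired with [h_k], the second derivatives of [Z] cancel by symmetry, its
    first derivatives cancel against the bracket term, and what remains is a multiple of
    [gauss u]. *)
Lemma local_curvature u : U u -> gauss u = 0 ->
  tproj u (x1 u *: d1 (fun y => tproj y (y1 y *: d1 Z y + y2 y *: d2 Z y)) u +
           x2 u *: d2 (fun y => tproj y (y1 y *: d1 Z y + y2 y *: d2 Z y)) u) -
  tproj u (y1 u *: d1 (fun y => tproj y (x1 y *: d1 Z y + x2 y *: d2 Z y)) u +
           y2 u *: d2 (fun y => tproj y (x1 y *: d1 Z y + x2 y *: d2 Z y)) u) -
  tproj u
   ((x1 u * d1 y1 u + x2 u * d2 y1 u - (y1 u * d1 x1 u + y2 u * d2 x1 u)) *: d1 Z u +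
    (x1 u * d1 y2 u + x2 u * d2 y2 u - (y1 u * d1 x2 u + y2 u * d2 x2 u)) *: d2 Z u)
  = 0.
Proof.
move=> Uu; rewrite /gauss => /subr0_eq G0; have hu := hreg Uu.
have sZ : smooth_on U Z by exact: smooth_on_comb.
rewrite !tprojB//; apply: tproj_eq0 => // k.
rewrite !(dotvDl, dotvNl) !dotvZl.
rewrite !(dotv_pder_nabla _ k sx1 sx2 Uu) !(dotv_pder_nabla _ k sy1 sy2 Uu).
rewrite (pderC oU ord_max ord0 sZ Uu).
have [->|->] := ord2P k.
- rewrite (sffC ord_max ord0 Uu) (dotvC (sff ord_max _ _)).
  rewrite (dotvC (sff ord0 ord_max _) (sff ord0 ord0 _)).
  by rewrite G0; ring.
- rewrite (dotvC (sff ord_max _ _) (sff ord0 ord_max _)) -!G0; ring.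
Qed.

End LocalSurface.

(** * Tangent and normal spaces expressed in a chart *)

Section Charts.
Context {R : realType} {M : smoothSurface R}.
Implicit Types (g X Y Z : M -> 'rV[R]_4) (c : chart R M) (u w : 'rV[R]_2).

Lemma chart_at_inv c u : atlas c -> chart_cod c u -> chart_at c (chart_inv c u).
Proof. by move=> ac cu; split=> //; exact: chart_inv_dom. Qed.

(** [A] is the differential of the transition map. It must not depend on [g]: one change of
    coordinates serves the immersion and the fields differentiated along it. *)
Lemma chart_change c c' p : chart_at c p -> chart_at c' p ->
  exists A : 'rV[R]_2 -> 'rV[R]_2, forall g,
    differentiable (g \o chart_inv c) (chart_map c p) ->
    forall w, chart_derive c' g p w = chart_derive c g p (A w).
Proof.
move=> [ac cp] [ac' c'p].
pose tau := chart_map c \o chart_inv c'; set q := chart_map c' p.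
have Uq : chart_cod c' q by exact: chart_map_cod.
have qp : chart_inv c' q = p by exact: chart_mapK.
exists ('d tau q) => g dg w; rewrite /chart_derive.
have dtau : differentiable tau q.
  apply: smooth_on_differentiable (atlas_compat ac' ac) _.
  by split=> //=; rewrite qp.
have tauq : tau q = chart_map c p by rewrite /tau /= qp.
have dg' : differentiable (g \o chart_inv c) (tau q) by rewrite tauq.
have -> : 'D_w (g \o chart_inv c') q = 'D_w ((g \o chart_inv c) \o tau) q.
  (* Inserting the transition map is legitimate only where [chart_inv c'] lands in the domain of
     [c], which holds near [q] by continuity. *)
  apply: near_eq_derive.
  have : \forall y \near q, chart_dom c (chart_inv c' y).
    apply: (chart_inv_continuous Uq); rewrite qp.
    by apply: open_nbhs_nbhs; split => //; exact: chart_dom_open.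
  by apply: filterS => y cy; rewrite /tau /= chart_mapK.
rewrite deriveE; last exact: differentiable_comp.
by rewrite diff_comp//= tauq [RHS]deriveE.
Qed.

Definition coords (s t : R) : 'rV[R]_2 := \row_i (if i == ord0 then s else t).

Lemma derive_coords (W : normedModType R) (f : 'rV[R]_2 -> W) s t u :
  differentiable f u -> 'D_(coords s t) f u = s *: d1 f u + t *: d2 f u.
Proof. by move=> df; rewrite derive_pder// !mxE. Qed.

Lemma chart_derive_inv c g u w : chart_cod c u ->
  chart_derive c g (chart_inv c u) w = 'D_w (g \o chart_inv c) u.
Proof. by move=> cu; rewrite /chart_derive chart_invK. Qed.

Lemma chart_derive_coords c g u s t : chart_cod c u ->
  differentiable (g \o chart_inv c) u ->
  chart_derive c g (chart_inv c u) (coords s t) =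
  s *: d1 (g \o chart_inv c) u + t *: d2 (g \o chart_inv c) u.
Proof. by move=> cu dg; rewrite chart_derive_inv// derive_coords. Qed.

Section InChart.
Variables (g : M -> 'rV[R]_4) (c : chart R M).
Hypotheses (img : immersion g) (ac : atlas c).
Let h := g \o chart_inv c.
Let U := chart_cod c.

Lemma smooth_chart Y : smooth_map Y -> smooth_on U (Y \o chart_inv c).
Proof. by apply. Qed.

Lemma immersion_smooth : smooth_on U h.
Proof. by apply: smooth_chart; have [] := img. Qed.

Lemma immersion_regular u : U u -> gram (d1 h u) (d2 h u) != 0.
Proof.
move=> Uu; have dh := smooth_on_differentiable immersion_smooth Uu.
apply: gram_neq0 => s t st0.
have [_ /(_ _ _ (chart_at_inv ac Uu)) inj] := img.
have E : coords s t = 0.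
  apply: inj; apply: (etrans (chart_derive_coords s t Uu dh)).
  by rewrite st0 chart_derive_inv// derive0.
have := congr1 (fun w : 'rV_2 => w ord0 ord0) E.
have := congr1 (fun w : 'rV_2 => w ord0 ord_max) E.
by rewrite !mxE/=.
Qed.

Lemma tangent_spaceP u t : U u -> tangent_space g (chart_inv c u) t <->
  exists s r, t = s *: d1 h u + r *: d2 h u.
Proof.
move=> Uu; have cu := chart_at_inv ac Uu.
have dh : differentiable h u by exact: smooth_on_differentiable immersion_smooth Uu.
split=> [[c' [w [cu' ->]]]|[s [r ->]]].
  have [A HA] := chart_change cu cu'.
  rewrite (HA g) ?chart_invK// (chart_derive_inv _ _ Uu) derive_pder//.
  by do 2 eexists.
exists c, (coords s r); split => //.
by rewrite (chart_derive_coords s r Uu dh).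
Qed.

Lemma normal_spaceP u v : U u -> normal_space g (chart_inv c u) v <->
  dotv v (d1 h u) = 0 /\ dotv v (d2 h u) = 0.
Proof.
move=> Uu; split=> [Nv|[v1 v2] t /(tangent_spaceP _ Uu)[s [r ->]]].
  split; apply: Nv; apply/(tangent_spaceP _ Uu).
    by exists 1, 0; rewrite scale1r scale0r addr0.
  by exists 0, 1; rewrite scale1r scale0r add0r.
by rewrite dotvDr !dotvZr v1 v2 !mulr0 addr0.
Qed.

(** The choice made by [xget] is forced: if [t] is tangent and [v - t] is normal, then [v - t]
    projects to 0 while [t] projects to itself. *)
Lemma tangent_partE u v : U u -> tangent_part g (chart_inv c u) v = tproj h u v.
Proof.
move=> Uu; have hu := immersion_regular Uu.
apply: xget_unique => [|t [/(tangent_spaceP _ Uu)[s [r ->]]]].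
  split; first by apply/(tangent_spaceP _ Uu); do 2 eexists.
  apply/(normal_spaceP _ Uu); exact: perpP.
move=> /(normal_spaceP _ Uu)[n1 n2]; apply/esym/eqP; rewrite -subr_eq0.
rewrite /tproj -(proj_comb hu) -(projN hu) -(projD hu).
by rewrite /plane_proj /coefl /coefr n1 n2 !mulr0 subr0 mul0r !scale0r addr0.
Qed.

Lemma normal_partE u v : U u ->
  normal_part g (chart_inv c u) v = plane_perp (d1 h u) (d2 h u) v.
Proof. by move=> Uu; rewrite /normal_part tangent_partE. Qed.

(** The choice of chart and coordinates is immaterial: any other choice is carried to [c] by the
    transition differential, and injectivity of the derivative of [g] forces the coordinates [s],
    [r] there. *)
Lemma dir_deriveE Y u s r : U u -> differentiable (Y \o chart_inv c) u ->
  dir_derive g Y (chart_inv c u) (s *: d1 h u + r *: d2 h u) =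
  s *: d1 (Y \o chart_inv c) u + r *: d2 (Y \o chart_inv c) u.
Proof.
move=> Uu dY; have cu := chart_at_inv ac Uu.
have dh : differentiable h u by exact: smooth_on_differentiable immersion_smooth Uu.
apply: xget_unique => [|z [c' [w [cu' tE ->]]]].
  exists c, (coords s r).
  by rewrite (chart_derive_coords s r Uu dh) (chart_derive_coords s r Uu dY).
have [A HA] := chart_change cu cu'.
have dg' : differentiable (g \o chart_inv c) (chart_map c (chart_inv c u)).
  by rewrite chart_invK.
have dY' : differentiable (Y \o chart_inv c) (chart_map c (chart_inv c u)).
  by rewrite chart_invK.
have [_ /(_ _ _ cu) inj] := img.
have Aw : A w = coords s r.
  apply: inj; apply: (etrans (esym (HA g dg' w))); apply: (etrans (esym tE)).
  exact: esym (chart_derive_coords s r Uu dh).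
by rewrite (HA Y dY' w) Aw (chart_derive_coords s r Uu dY).
Qed.

Lemma tangent_coords X u : U u -> tangent_space g (chart_inv c u) (X (chart_inv c u)) ->
  X (chart_inv c u) =
  coefl (d1 h u) (d2 h u) (X (chart_inv c u)) *: d1 h u +
  coefr (d1 h u) (d2 h u) (X (chart_inv c u)) *: d2 h u.
Proof.
move=> Uu /(tangent_spaceP _ Uu)[s [r ->]].
by have [-> ->] := coef_comb (immersion_regular Uu) s r.
Qed.

End InChart.

Lemma chart_point p : exists c u, [/\ atlas c, chart_cod c u & p = chart_inv c u].
Proof.
have [c ac cp] := atlas_cover p; exists c, (chart_map c p); split=> //.
  exact: chart_map_cod.
by rewrite chart_mapK.
Qed.

(** The field is the tangential part of the constant vector [t], smooth because the projection
    coefficients are. *)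
Lemma tangent_field_ext g p t : immersion g -> tangent_space g p t ->
  exists2 X, tangent_field g X & X p = t.
Proof.
move=> img tp; exists (fun q => tangent_part g q t).
  split=> [c ac|q].
    have oU := @chart_cod_open _ _ c; have hreg := immersion_regular img ac.
    have sdh i := smooth_on_pder i (immersion_smooth img ac).
    have := smooth_on_proj oU (sdh ord0) (sdh ord_max)
      (@smooth_on_cst _ _ (chart_cod c) _ t) hreg.
    by apply: smooth_on_ext => // u Uu /=; rewrite tangent_partE.
  have [c [u [ac Uu ->]]] := chart_point q.
  rewrite (tangent_partE img ac)//; apply/(tangent_spaceP img ac) => //.
  by do 2 eexists.
have [c [u [ac Uu pE]]] := chart_point p.
rewrite pE (tangent_partE img ac)//.
move: tp; rewrite pE => /(tangent_spaceP img ac _ Uu)[s [r ->]].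
by rewrite /tproj proj_comb//; exact: immersion_regular.
Qed.

End Charts.

(** * Covariant derivative, curvature and curvature ellipse in a chart *)

Section FieldsInChart.
Context {R : realType} {M : smoothSurface R}.
Variables (g : M -> 'rV[R]_4) (c : chart R M).
Hypotheses (img : immersion g) (ac : atlas c).
Let h := g \o chart_inv c.
Let U := chart_cod c.
Let oU : open U := @chart_cod_open _ _ c.
Let sh : smooth_on U h := immersion_smooth img ac.
Let hreg u : U u -> gram (d1 h u) (d2 h u) != 0 := immersion_regular img ac (u := u).
Implicit Types (X Y Z : M -> 'rV[R]_4) (u : 'rV[R]_2).

Definition field_coefl X u := coefl (d1 h u) (d2 h u) (X (chart_inv c u)).
Definition field_coefr X u := coefr (d1 h u) (d2 h u) (X (chart_inv c u)).

Lemma smooth_field_coefl X : tangent_field g X -> smooth_on U (field_coefl X).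
Proof.
move=> [sX _]; apply: smooth_on_coefl => //; first exact: smooth_on_pder.
  exact: smooth_on_pder.
exact: smooth_chart.
Qed.

Lemma smooth_field_coefr X : tangent_field g X -> smooth_on U (field_coefr X).
Proof.
move=> [sX _]; apply: smooth_on_coefr => //; first exact: smooth_on_pder.
  exact: smooth_on_pder.
exact: smooth_chart.
Qed.

Lemma field_coefE X u : tangent_field g X -> U u ->
  X (chart_inv c u) = field_coefl X u *: d1 h u + field_coefr X u *: d2 h u.
Proof. by move=> [_ tX] Uu; exact: tangent_coords. Qed.

(** The assumptions are pointwise so that the formula also covers differentiating [nabla g Y Z] and
    differentiating along [lie_bracket g X Y]. *)
Lemma field_deriveE X Y u : tangent_space g (chart_inv c u) (X (chart_inv c u)) ->
  U u -> differentiable (Y \o chart_inv c) u ->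
  field_derive g X Y (chart_inv c u) =
  field_coefl X u *: d1 (Y \o chart_inv c) u +
  field_coefr X u *: d2 (Y \o chart_inv c) u.
Proof.
move=> tX Uu dY; rewrite /field_derive (tangent_coords img ac Uu tX).
exact: dir_deriveE.
Qed.

Lemma field_deriveE_smooth X Y u : tangent_field g X -> smooth_map Y -> U u ->
  field_derive g X Y (chart_inv c u) =
  field_coefl X u *: d1 (Y \o chart_inv c) u +
  field_coefr X u *: d2 (Y \o chart_inv c) u.
Proof.
move=> [_ tX] sY Uu; apply: field_deriveE => //.
exact: smooth_on_differentiable (smooth_chart ac sY) Uu.
Qed.

Lemma nablaE X Y u : tangent_field g X -> smooth_map Y -> U u ->
  nabla g X Y (chart_inv c u) =
  tproj h u (field_coefl X u *: d1 (Y \o chart_inv c) u +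
             field_coefr X u *: d2 (Y \o chart_inv c) u).
Proof. by move=> tX sY Uu; rewrite /nabla tangent_partE// field_deriveE_smooth. Qed.

Definition field_coord X u : 'rV[R]_4 :=
  field_coefl X u *: d1 h u + field_coefr X u *: d2 h u.

Lemma pder_field X i u : tangent_field g X -> U u ->
  pder i (X \o chart_inv c) u = pder i (field_coord X) u.
Proof. by move=> tX Uu; apply: (pder_ext oU) => // y Uy; exact: field_coefE. Qed.

Lemma nabla_coordE X Y u : tangent_field g X -> tangent_field g Y -> U u ->
  nabla g X Y (chart_inv c u) =
  tproj h u (field_coefl X u *: d1 (field_coord Y) u +
             field_coefr X u *: d2 (field_coord Y) u).
Proof.
move=> tX tY Uu; have [sY _] := tY.
by rewrite (nablaE tX sY Uu) !(pder_field _ tY Uu).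
Qed.

Lemma smooth_field_coord X : tangent_field g X -> smooth_on U (field_coord X).
Proof.
move=> tX; apply: smooth_on_comb => //.
- exact: smooth_field_coefl.
- exact: smooth_field_coefr.
- exact: smooth_on_pder.
- exact: smooth_on_pder.
Qed.

(** The inner covariant derivative agrees with its coordinate expression on all of the open set [U],
    so the two may be exchanged under the outer derivative. *)
Lemma nabla_nablaE X Y Z u : tangent_field g X -> tangent_field g Y ->
  tangent_field g Z -> U u ->
  nabla g X (nabla g Y Z) (chart_inv c u) =
  tproj h u
    (field_coefl X u *: d1 (fun y => tproj h y
       (field_coefl Y y *: d1 (field_coord Z) y + field_coefr Y y *: d2 (field_coord Z) y)) u +
     field_coefr X u *: d2 (fun y => tproj h y
       (field_coefl Y y *: d1 (field_coord Z) y + field_coefr Y y *: d2 (field_coord Z) y)) u).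
Proof.
move=> tX tY tZ Uu; set N := fun y => _.
have NE y : U y -> N y = (nabla g Y Z \o chart_inv c) y.
  by move=> Uy /=; rewrite nabla_coordE.
have sN : smooth_on U N.
  apply: smooth_on_proj => //; [exact: smooth_on_pder..|].
  apply: smooth_on_comb => //.
  - exact: smooth_field_coefl.
  - exact: smooth_field_coefr.
  - by apply: smooth_on_pder; exact: smooth_field_coord.
  - by apply: smooth_on_pder; exact: smooth_field_coord.
have dN : differentiable (nabla g Y Z \o chart_inv c) u.
  have := smooth_on_ext oU NE sN.
  by move=> sN'; exact: smooth_on_differentiable sN' Uu.
rewrite {1}/nabla tangent_partE// field_deriveE//; last by have [_] := tX.
by rewrite -!(pder_ext oU _ NE Uu).
Qed.

Lemma lie_bracketE X Y u : tangent_field g X -> tangent_field g Y -> U u ->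
  lie_bracket g X Y (chart_inv c u) =
  (field_coefl X u * d1 (field_coefl Y) u + field_coefr X u * d2 (field_coefl Y) u -
   (field_coefl Y u * d1 (field_coefl X) u + field_coefr Y u * d2 (field_coefl X) u))
    *: d1 h u +
  (field_coefl X u * d1 (field_coefr Y) u + field_coefr X u * d2 (field_coefr Y) u -
   (field_coefl Y u * d1 (field_coefr X) u + field_coefr Y u * d2 (field_coefr X) u))
    *: d2 h u.
Proof.
move=> tX tY Uu; have [sX _] := tX; have [sY _] := tY; rewrite /lie_bracket.
rewrite (field_deriveE_smooth tX sY Uu) (field_deriveE_smooth tY sX Uu).
rewrite !(pder_field _ tX Uu) !(pder_field _ tY Uu).
have := local_bracket oU sh (smooth_field_coefl tX) (smooth_field_coefr tX)
  (smooth_field_coefl tY) (smooth_field_coefr tY) Uu.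
by apply: etrans.
Qed.

Lemma curvature_eq0 X Y Z u : tangent_field g X -> tangent_field g Y ->
  tangent_field g Z -> U u -> gauss h u = 0 ->
  curvature g X Y Z (chart_inv c u) = 0.
Proof.
move=> tX tY tZ Uu G0; rewrite /curvature (nabla_nablaE tX tY tZ Uu).
rewrite (nabla_nablaE tY tX tZ Uu) {1}/nabla tangent_partE//.
have [sZ _] := tZ.
have bE := lie_bracketE tX tY Uu.
rewrite field_deriveE//; first last.
- exact: smooth_on_differentiable (smooth_chart ac sZ) Uu.
- rewrite bE; apply/(tangent_spaceP img ac) => //; by do 2 eexists.
(* Reads off the coordinates of the bracket, in the form [local_curvature] expects. *)
have [lE rE] := coef_comb (hreg Uu)
  (field_coefl X u * d1 (field_coefl Y) u + field_coefr X u * d2 (field_coefl Y) u -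
   (field_coefl Y u * d1 (field_coefl X) u + field_coefr Y u * d2 (field_coefl X) u))
  (field_coefl X u * d1 (field_coefr Y) u + field_coefr X u * d2 (field_coefr Y) u -
   (field_coefl Y u * d1 (field_coefr X) u + field_coefr Y u * d2 (field_coefr X) u)).
rewrite -bE in lE rE; rewrite !(pder_field _ tZ Uu).
rewrite [field_coefl (lie_bracket g X Y) u]lE [field_coefr (lie_bracket g X Y) u]rE.
exact: (local_curvature oU sh hreg (smooth_field_coefl tX) (smooth_field_coefr tX)
  (smooth_field_coefl tY) (smooth_field_coefr tY)
  (smooth_field_coefl tZ) (smooth_field_coefr tZ) Uu G0).
Qed.

(** The value of the second fundamental form on [(w, w)] for [w = s h_1 + t h_2]. *)
Definition sff_quad (s t : R) u : 'rV[R]_4 :=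
  (s * s) *: sff h ord0 ord0 u + (s * t *+ 2) *: sff h ord0 ord_max u +
  (t * t) *: sff h ord_max ord_max u.

Lemma dotv_sff_quad s t u n : dotv (sff_quad s t u) n =
  s * s * dotv (sff h ord0 ord0 u) n + s * t *+ 2 * dotv (sff h ord0 ord_max u) n +
  t * t * dotv (sff h ord_max ord_max u) n.
Proof. by rewrite /sff_quad dotvDl dotvDl !dotvZl. Qed.

Lemma second_formE X s t u : tangent_field g X -> U u ->
  X (chart_inv c u) = s *: d1 h u + t *: d2 h u ->
  second_form g X X (chart_inv c u) = sff_quad s t u.
Proof.
move=> tX Uu Xst; have [sX _] := tX.
have [lE rE] : field_coefl X u = s /\ field_coefr X u = t.
  by rewrite /field_coefl /field_coefr Xst; exact: coef_comb (hreg Uu) s t.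
rewrite /second_form normal_partE// (field_deriveE_smooth tX sX Uu).
rewrite !(pder_field _ tX Uu) (perpD (hreg Uu)) !(perpZ (hreg Uu)).
rewrite !(perp_pder_comb oU sh hreg _ (smooth_field_coefl tX) (smooth_field_coefr tX) Uu).
rewrite lE rE /sff_quad (sffC oU sh ord_max ord0 Uu).
by apply/rowP => i; rewrite !mxE; ring.
Qed.

Lemma curvature_ellipseP v u : U u -> curvature_ellipse g (chart_inv c u) v <->
  exists s t, let w := s *: d1 h u + t *: d2 h u in
    w != 0 /\ v = (dotv w w)^-1 *: sff_quad s t u.
Proof.
move=> Uu; split=> [[w [X [/(tangent_spaceP img ac _ Uu)[s [t wE]] w0 tX Xw ->]]]|].
  exists s, t => /=; rewrite -wE; split=> //.
  by rewrite (second_formE tX Uu (etrans Xw wE)).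
move=> [s [t [w0 ->]]].
have tw : tangent_space g (chart_inv c u) (s *: d1 h u + t *: d2 h u).
  by apply/(tangent_spaceP img ac _ Uu); do 2 eexists.
have [X tX Xw] := tangent_field_ext img tw.
exists (s *: d1 h u + t *: d2 h u), X; split => //.
by rewrite (second_formE tX Uu Xw).
Qed.

End FieldsInChart.

(** * Identities for binary quadratic and cubic forms *)

Section Algebra.
Context {R : realFieldType}.

(** The symmetric matrix with entries [E], [F], [G] annihilates [(l, - k)]; multiplying by its
    adjugate gives the determinant. *)
Lemma gram_mul_eq0 (E F G k l : R) : E * l = F * k -> F * l = G * k ->
  (E * G - F ^+ 2) * k = 0 /\ (E * G - F ^+ 2) * l = 0.
Proof.
move=> /eqP; rewrite -subr_eq0 => /eqP H1 /eqP; rewrite -subr_eq0 => /eqP H2.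
split.
  transitivity (F * (E * l - F * k) - E * (F * l - G * k)); first by ring.
  by rewrite H1 H2; ring.
transitivity (G * (E * l - F * k) - F * (F * l - G * k)); first by ring.
by rewrite H1 H2; ring.
Qed.

(* The left-hand side is a combination of the 2x2 minors of the catalecticant
   (A B C; B C D); multiplied by k it becomes an identically zero determinant. *)
Lemma binary_cubic_minors (A B C D E F G p q k : R) : (p, q) != (0, 0) ->
  p * A + q * B = k * E -> p * B + q * C = k * F -> p * C + q * D = k * G ->
  G * (A * C - B ^+ 2) - F * (A * D - B * C) + E * (B * D - C ^+ 2) = 0.
Proof.
move=> pq0 HE HF HG; have [k0|k0] := eqVneq k 0; last first.
  apply: (mulfI k0); rewrite mulr0 mulrDr mulrBr !mulrA -HE -HF -HG; ring.
move: HE HF HG; rewrite k0 !mul0r => HE HF HG.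
(* For [k = 0] the pairs [(A, B)], [(B, C)], [(C, D)] are all orthogonal to the nonzero [(p, q)],
   hence pairwise proportional. Each minor is shown to vanish after multiplication by [p] and by
   [q]. *)
suff [-> -> ->] : [/\ A * C - B ^+ 2 = 0, A * D - B * C = 0 & B * D - C ^+ 2 = 0].
  by rewrite !mulr0 subr0 addr0.
have cancel x : p * x = 0 -> q * x = 0 -> x = 0.
  move=> /eqP + /eqP; rewrite !mulf_eq0 => /orP[/eqP p0|/eqP//] /orP[/eqP q0|/eqP//].
  by move: pq0; rewrite p0 q0 eqxx.
split; apply: cancel.
- transitivity (C * (p * A + q * B) - B * (p * B + q * C)); first by ring.
  by rewrite HE HF; ring.
- transitivity (A * (p * B + q * C) - B * (p * A + q * B)); first by ring.
  by rewrite HE HF; ring.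
- transitivity (D * (p * A + q * B) - B * (p * C + q * D)); first by ring.
  by rewrite HE HG; ring.
- transitivity (A * (p * C + q * D) - C * (p * A + q * B)); first by ring.
  by rewrite HE HG; ring.
- transitivity (D * (p * B + q * C) - C * (p * C + q * D)); first by ring.
  by rewrite HF HG; ring.
- transitivity (B * (p * C + q * D) - C * (p * B + q * C)); first by ring.
  by rewrite HF HG; ring.
Qed.

End Algebra.

(** * The envelope in local coordinates and its cubic form *)

Section Envelope.
Context {R : realType} (U : set 'rV[R]_2) (h eps phi : 'rV[R]_2 -> 'rV[R]_4).
Hypotheses (oU : open U) (sh : smooth_on U h) (seps : smooth_on U eps).
Hypothesis hreg : forall u, U u -> gram (d1 h u) (d2 h u) != 0.
Variables a b : 'rV[R]_2 -> R.
Hypotheses (sa : smooth_on U a) (sb : smooth_on U b).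
Hypothesis epsE : forall u, U u -> eps u = a u *: d1 h u + b u *: d2 h u.
Hypothesis tproj_pder_eps : forall i u, U u -> tproj h u (pder i eps u) = pder i h u.
Hypothesis phiE : forall u, phi u = h u - eps u.

Let sdh i : smooth_on U (pder i h) := smooth_on_pder i sh.

Lemma smooth_envelope : smooth_on U phi.
Proof.
have := smooth_onB oU sh seps.
by apply: smooth_on_ext => // u _; rewrite phiE.
Qed.
Let sphi := smooth_envelope.
Let sdphi i : smooth_on U (pder i phi) := smooth_on_pder i sphi.

Lemma pder_envelope i u : U u -> pder i phi u = pder i h u - pder i eps u.
Proof.
move=> Uu; rewrite -(pderB i sh seps Uu); exact: (pder_ext oU).
Qed.

Lemma dotv_pder_envelope i k u : U u -> dotv (pder i phi u) (pder k h u) = 0.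
Proof.
move=> Uu; rewrite (pder_envelope i Uu) dotvDl dotvNl.
have [pl pr] := projP (hreg Uu) (pder i eps u).
rewrite -(tproj_pder_eps i Uu) /tproj.
by have [->|->] := ord2P k; rewrite ?pl ?pr subrr.
Qed.

Definition cubic i j k u := dotv (pder i (pder j phi) u) (pder k h u).

Lemma dotv_envelope_pder2 i j k u : U u ->
  dotv (pder j phi u) (pder i (pder k h) u) = - cubic i j k u.
Proof.
move=> Uu; have := pder_dotv i (sdphi j) (sdh k) Uu.
rewrite (pder_ext (g := fun _ => 0) oU) => [|y Uy|//]; last exact: dotv_pder_envelope.
by rewrite pder_cst => /esym/eqP; rewrite addrC addr_eq0 => /eqP.
Qed.

Lemma cubicC i j k u : U u -> cubic i j k u = cubic j i k u.
Proof. by move=> Uu; rewrite /cubic (pderC oU i j sphi Uu). Qed.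

(** This comes from the symmetry of [h_ik]; together with [cubicC], from that of [phi_ij], it
    generates all permutations of the indices. *)
Lemma cubicCA i j k u : U u -> cubic i j k u = cubic k j i u.
Proof.
move=> Uu; apply: oppr_inj; rewrite -!dotv_envelope_pder2//.
by rewrite (pderC oU i k sh Uu).
Qed.

Lemma perp_pder_eps i u : U u ->
  plane_perp (d1 h u) (d2 h u) (pder i eps u) =
  a u *: sff h i ord0 u + b u *: sff h i ord_max u.
Proof.
by move=> Uu; rewrite (pder_ext oU i epsE Uu); exact: (perp_pder_comb oU sh hreg i sa sb Uu).
Qed.

Lemma pder_envelope_sff i u : U u ->
  pder i phi u = - (a u *: sff h i ord0 u + b u *: sff h i ord_max u).
Proof.
move=> Uu; rewrite -perp_pder_eps// /plane_perp opprB pder_envelope//.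
by have := tproj_pder_eps i Uu; rewrite /tproj => ->.
Qed.

Lemma cubic_sff i j k u : U u -> cubic i j k u =
  a u * dotv (sff h j ord0 u) (sff h i k u) + b u * dotv (sff h j ord_max u) (sff h i k u).
Proof.
move=> Uu; apply: oppr_inj; rewrite -dotv_envelope_pder2// pder_envelope_sff//.
by rewrite dotvNl dotvDl !dotvZl /sff !(dotv_perp (hreg Uu)).
Qed.

(** Exchanging the two distinct first indices of the cubic form gives [b K = 0] when the third index
    is the first coordinate, and [a K = 0] when it is the second. *)
Lemma gauss_comb_eq0 u : U u -> a u * gauss h u = 0 /\ b u * gauss h u = 0.
Proof.
move=> Uu; have C k := cubicC ord0 ord_max k Uu.
move: (C ord0) (C ord_max); rewrite !cubic_sff// (sffC oU sh ord_max ord0 Uu) /gauss.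
rewrite (dotvC (sff h ord_max ord_max u) (sff h ord0 ord0 u)).
rewrite (dotvC (sff h ord_max ord_max u) (sff h ord0 ord_max u)).
rewrite (dotvC (sff h ord0 ord_max u) (sff h ord0 ord0 u)).
by split; lra.
Qed.

Lemma gauss_eq0 u : U u -> gauss h u = 0.
Proof.
move=> Uu; have [aG bG] := gauss_comb_eq0 Uu.
apply/eqP/contraT => G0; have {aG}a0 : a u = 0.
  by move/eqP: aG; rewrite mulf_eq0 (negPf G0) orbF => /eqP.
have {bG}b0 : b u = 0.
  by move/eqP: bG; rewrite mulf_eq0 (negPf G0) orbF => /eqP.
have sff_smooth i j : smooth_on U (sff h i j).
  by apply: smooth_on_perp => //; apply: smooth_on_pder.
have sG : smooth_on U (gauss h).
  by apply: smooth_onB => //; apply: smooth_on_dotv.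
(* At a point with [b = 0] and nonzero [gauss], this derivative forces [d2 b u = 0]. *)
have : d2 (fun y => b y * gauss h y) u = 0.
  rewrite (pder_ext (g := fun _ => 0) oU) ?pder_cst// => y Uy.
  by have [] := gauss_comb_eq0 Uy.
rewrite (pderM _ sb sG Uu) b0 mul0r addr0 => /eqP.
rewrite mulf_eq0 (negPf G0) orbF => /eqP b20.
(* With [a], [b] and [d2 b] zero at [u], the equation for [eps_2] would make [h_2] a multiple of
   [h_1]. *)
have := tproj_pder_eps ord_max Uu.
rewrite (pder_ext oU _ epsE Uu) (pder_comb oU _ sa sb (sdh _) (sdh _) Uu).
rewrite a0 b0 b20 !scale0r !addr0 => E.
have [_ pr] := projP (hreg Uu) (d2 a u *: d1 h u).
have [_ /eqP] : d2 a u = 0 /\ 0 = 1 :> R; last by rewrite eq_sym oner_eq0.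
apply: (comb_inj (hreg Uu)); rewrite -(proj_comb (hreg Uu) (d2 a u) 0).
by rewrite scale0r addr0 [LHS]E scale0r scale1r add0r.
Qed.

Section ImmersedEnvelope.
Hypothesis phireg : forall u, U u -> gram (d1 phi u) (d2 phi u) != 0.

Let T_perp i k u : U u -> dotv (pder i h u) (pder k phi u) = 0.
Proof. by move=> Uu; rewrite dotvC dotv_pder_envelope. Qed.

Lemma eq0_of_orth u v : U u -> (forall i, dotv v (pder i h u) = 0) ->
  (forall i, dotv v (pder i phi u) = 0) -> v = 0.
Proof.
by move=> Uu vh vphi; apply: (dim4_orth_eq0 (hreg Uu) (phireg Uu)); rewrite ?T_perp.
Qed.

(** The normal plane of the envelope is the tangent plane of the surface: [v - tproj h u v] is
    orthogonal to the basis [h_1], [h_2], [phi_1], [phi_2]. *)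
Lemma tproj_orth u v : U u -> (forall i, dotv v (pder i phi u) = 0) ->
  tproj h u v = v.
Proof.
move=> Uu vphi; apply/esym/eqP; rewrite -subr_eq0; apply/eqP.
have [pl pr] := projP (hreg Uu) v.
apply: (eq0_of_orth Uu) => i; rewrite dotvDl dotvNl.
  by rewrite /tproj; have [->|->] := ord2P i; rewrite ?pl ?pr subrr.
by rewrite vphi dotvDl !dotvZl !T_perp// !mulr0 addr0 subr0.
Qed.

Lemma dotv_eps_envelope i u : U u -> dotv (eps u) (pder i phi u) = 0.
Proof. by move=> Uu; rewrite epsE// dotvDl !dotvZl !T_perp// !mulr0 addr0. Qed.

Lemma dotv_pder2_envelope_eps i j u : U u ->
  dotv (pder i (pder j phi) u) (eps u) = dotv (pder i phi u) (pder j phi u).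
Proof.
move=> Uu; have := pder_dotv i (sdphi j) seps Uu.
rewrite (pder_ext (g := fun _ => 0) oU) => [||//]; last first.
  by move=> y Uy; rewrite dotvC dotv_eps_envelope.
rewrite pder_cst (_ : pder i eps u = pder i h u - pder i phi u); last first.
  by rewrite pder_envelope// opprB addrC subrK.
rewrite dotvDr dotvNr dotv_pder_envelope// add0r => /esym/eqP.
by rewrite subr_eq0 => /eqP ->; exact: dotvC.
Qed.

Lemma dotv_sff_envelope_eps i j u : U u ->
  dotv (sff phi i j u) (eps u) = dotv (pder i phi u) (pder j phi u).
Proof.
move=> Uu; rewrite -dotv_pder2_envelope_eps//.
by rewrite /sff dotv_perp_orth// dotv_eps_envelope.
Qed.

Lemma dotv_sff_envelope i j k u : U u ->
  dotv (sff phi i j u) (pder k h u) = cubic i j k u.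
Proof.
by move=> Uu; rewrite /sff dotv_perp_orth// T_perp.
Qed.

Lemma dotv_sff_envelope_orth i j k u : U u ->
  dotv (sff phi i j u) (pder k phi u) = 0.
Proof.
move=> Uu; have [pl pr] := perpP (phireg Uu) (pder i (pder j phi) u).
by have [->|->] := ord2P k.
Qed.

Lemma tproj_sff_envelope i j u : U u -> tproj h u (sff phi i j u) = sff phi i j u.
Proof. by move=> Uu; apply: tproj_orth => // k; exact: dotv_sff_envelope_orth. Qed.

(** The second fundamental form of the envelope lies in the plane of [h_1], [h_2], where its
    pairings with that basis are the cubic form. This is the inner product through the inverse
    metric, with the denominator cleared. *)
Lemma gram_dotv_sff_envelope i j k l u : U u ->
  gram (d1 h u) (d2 h u) * dotv (sff phi i j u) (sff phi k l u) =
  dotv (d2 h u) (d2 h u) * (cubic i j ord0 u * cubic k l ord0 u) -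
  dotv (d1 h u) (d2 h u) * (cubic i j ord0 u * cubic k l ord_max u +
                            cubic i j ord_max u * cubic k l ord0 u) +
  dotv (d1 h u) (d1 h u) * (cubic i j ord_max u * cubic k l ord_max u).
Proof.
move=> Uu; rewrite -(tproj_sff_envelope i j Uu) /tproj /plane_proj dotvDl !dotvZl.
rewrite ![dotv (pder _ h u) (sff _ _ _ _)]dotvC /coefl /coefr.
rewrite !dotv_sff_envelope//; have := hreg Uu.
by move: (gram _ _) => G G0; field.
Qed.

(** Since [phi_i . phi_j = phi_ij . eps], a zero of [eps] would make the first fundamental form of
    the envelope vanish. *)
Lemma eps_neq0 u : U u -> eps u != 0.
Proof.
move=> Uu; apply: contra_neq (phireg Uu) => e0; rewrite /gram.
by rewrite -!dotv_pder2_envelope_eps// e0 !dotv0r mul0r expr2 mul0r subr0.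
Qed.

Lemma envelope_not_umbilic u m : U u ->
  (forall i j, sff phi i j u = dotv (pder i phi u) (pder j phi u) *: m) -> False.
Proof.
move=> Uu sffE.
have cE i j k : cubic i j k u = dotv (pder i phi u) (pder j phi u) * dotv m (pder k h u).
  by rewrite -dotv_sff_envelope// sffE dotvZl.
have cubicCr i j k : cubic i j k u = cubic i k j u.
  by rewrite (cubicC i j k Uu) (cubicCA j i k Uu) (cubicC k i j Uu).
have m0 k : dotv m (pder k h u) = 0.
  apply: (mulfI (phireg Uu)); rewrite mulr0 /gram.
  (* Symmetry in the last two indices becomes a homogeneous linear system for [m . h_1] and
     [m . h_2], whose determinant is up to sign the Gram determinant of [phi]. *)
  have := cubicCr ord0 ord0 ord_max; have := cubicCr ord_max ord0 ord_max.
  rewrite !cE (dotvC (d2 phi u) (d1 phi u)) => E1 E2.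
  have [ml mr] := gram_mul_eq0 E2 E1.
  by have [->|->] := ord2P k.
have : dotv m (eps u) = 1.
  have : dotv (sff phi ord0 ord0 u) (eps u) = dotv (d1 phi u) (d1 phi u).
    exact: dotv_sff_envelope_eps.
  rewrite sffE dotvZl -[RHS]mulr1; apply: mulfI.
  apply: contra_neq (phireg Uu) => /eqP; rewrite dotvv_eq0 => /eqP E.
  by rewrite /gram E !dotv0l mul0r expr2 mul0r subr0.
rewrite epsE// dotvDr !dotvZr !m0 !mulr0 addr0 => /esym/eqP.
by rewrite oner_eq0.
Qed.

(** By total symmetry the cubic form has four coefficients, and the Gram determinant of [h] times
    [gauss phi u] is exactly the combination of minors in [binary_cubic_minors]. *)
Lemma gauss_envelope_eq0 u (p q k : R) : U u -> (p, q) != (0, 0) ->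
  (forall i j, p * cubic i ord0 j u + q * cubic i ord_max j u =
               k * dotv (pder i h u) (pder j h u)) ->
  gauss phi u = 0.
Proof.
move=> Uu pq0 E; apply: (mulfI (hreg Uu)); rewrite mulr0 /gauss mulrBr.
rewrite !gram_dotv_sff_envelope//.
move: (E ord0 ord0) (E ord0 ord_max) (E ord_max ord_max).
rewrite (cubicC ord0 ord_max ord0 Uu) (cubicCA ord_max ord0 ord0 Uu).
rewrite (cubicC ord_max ord0 ord_max Uu) (cubicCA ord_max ord_max ord0 Uu) => E0 E1 E2.
apply: etrans (binary_cubic_minors pq0 E0 E1 E2); ring.
Qed.


End ImmersedEnvelope.
End Envelope.

(** An affine condition on the ellipse says that two quadratic forms in the tangent vector agree;
    polarization compares their coefficients. *)
Lemma ellipse_dotv_const (R : realType) (M : smoothSurface R) (g : M -> 'rV[R]_4)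
    (c : chart R M) (u : 'rV[R]_2) (n : 'rV[R]_4) (k : R) :
  immersion g -> atlas c -> chart_cod c u ->
  (forall v, curvature_ellipse g (chart_inv c u) v -> dotv v n = k) ->
  forall i j, dotv (sff (g \o chart_inv c) i j u) n =
    k * dotv (pder i (g \o chart_inv c) u) (pder j (g \o chart_inv c) u).
Proof.
move=> img ac Uu; set h := g \o chart_inv c => nk.
have hreg : gram (d1 h u) (d2 h u) != 0 by exact: immersion_regular.
have Q s t : s * s * dotv (sff h ord0 ord0 u) n + s * t *+ 2 * dotv (sff h ord0 ord_max u) n +
    t * t * dotv (sff h ord_max ord_max u) n =
    k * (s * s * dotv (d1 h u) (d1 h u) + s * t *+ 2 * dotv (d1 h u) (d2 h u) +
         t * t * dotv (d2 h u) (d2 h u)).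
  have [w0|w0] := eqVneq (s *: d1 h u + t *: d2 h u) 0.
    have [-> ->] : s = 0 /\ t = 0.
      by apply: (comb_inj hreg); rewrite w0 !scale0r addr0.
    by rewrite !mul0r mul0rn !mul0r !addr0 mulr0.
  have := nk _ ((curvature_ellipseP img ac _ Uu).2
    (ex_intro _ s (ex_intro _ t (conj w0 erefl)))).
  rewrite dotvZl -/h -dotvv_eq0 in w0 *.
  move=> /(congr1 ( *%R (dotv (s *: d1 h u + t *: d2 h u) (s *: d1 h u + t *: d2 h u)))).
  rewrite mulrA divff// mul1r dotv_sff_quad -/h => ->.
  rewrite dotvDl !dotvDr !dotvZl !dotvZr (dotvC (d2 h u) (d1 h u)); ring.
(* Three directions determine a binary quadratic form. *)
have Q00 := Q 1 0; have Q11 := Q 0 1; have Q01 := Q 1 1.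
have E00 : dotv (sff h ord0 ord0 u) n = k * dotv (d1 h u) (d1 h u) by lra.
have E11 : dotv (sff h ord_max ord_max u) n = k * dotv (d2 h u) (d2 h u) by lra.
have E01 : dotv (sff h ord0 ord_max u) n = k * dotv (d1 h u) (d2 h u) by lra.
have E10 : dotv (sff h ord_max ord0 u) n = k * dotv (d2 h u) (d1 h u).
  rewrite (sffC (@chart_cod_open _ _ c) (immersion_smooth img ac))//.
  by rewrite E01 dotvC.
by move=> i j; have [->|->] := ord2P i; have [->|->] := ord2P j.
Qed.

(** * Pointwise conclusions about the surface and its envelope in a chart *)

Section EnvelopeInChart.
Context {R : realType} {M : smoothSurface R}.
Variables (x e f : M -> 'rV[R]_4).
Hypotheses (x_immersion : immersion x) (e_field : tangent_field x e).
Hypothesis nabla_e : forall X : M -> 'rV[R]_4, tangent_field x X ->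
  forall p : M, nabla x X e p = X p.
Hypothesis fE : forall p : M, f p = x p - e p.
Variable c : chart R M.
Hypothesis ac : atlas c.

Let U := chart_cod c.
Let h := x \o chart_inv c.
Let eps := e \o chart_inv c.
Let phi := f \o chart_inv c.
Let oU : open U := @chart_cod_open R M c.
Let sh : smooth_on U h := immersion_smooth x_immersion ac.
Let hreg u : U u -> gram (d1 h u) (d2 h u) != 0 :=
  immersion_regular x_immersion ac (u := u).
Let seps : smooth_on U eps := smooth_chart ac e_field.1.
Let a := field_coefl x c e.
Let b := field_coefr x c e.
Let sa : smooth_on U a := smooth_field_coefl x_immersion ac e_field.
Let sb : smooth_on U b := smooth_field_coefr x_immersion ac e_field.
Let epsE u : U u -> eps u = a u *: d1 h u + b u *: d2 h u.
Proof. exact: field_coefE. Qed.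
Let phiE u : phi u = h u - eps u. Proof. exact: fE. Qed.

(** The hypothesis on [e] concerns global fields, so the tangent vector at the point is first
    extended to one. *)
Lemma tproj_comb_field u s r : U u ->
  tproj h u (s *: d1 eps u + r *: d2 eps u) = s *: d1 h u + r *: d2 h u.
Proof.
move=> Uu; have [X tX Xp] := tangent_field_ext x_immersion
  ((tangent_spaceP x_immersion ac (s *: d1 h u + r *: d2 h u) Uu).2
     (ex_intro _ s (ex_intro _ r erefl))).
have := nabla_e tX (chart_inv c u).
rewrite (nablaE x_immersion ac tX e_field.1 Uu) /field_coefl /field_coefr Xp.
by have [-> ->] := coef_comb (hreg Uu) s r.
Qed.

Lemma tproj_pder_field i u : U u -> tproj h u (pder i eps u) = pder i h u.
Proof.
move=> Uu; have [->|->] := ord2P i.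
  by have := tproj_comb_field 1 0 Uu; rewrite !scale1r !scale0r !addr0.
by have := tproj_comb_field 0 1 Uu; rewrite !scale1r !scale0r !add0r.
Qed.
Let pe := tproj_pder_field.

Lemma gauss_surface_eq0 u : U u -> gauss h u = 0.
Proof. exact: (gauss_eq0 oU sh seps hreg sa sb epsE pe phiE). Qed.

Hypothesis f_immersion : immersion f.
Let phireg u : U u -> gram (d1 phi u) (d2 phi u) != 0 :=
  immersion_regular f_immersion ac (u := u).
Let orth i k u : U u -> dotv (pder i phi u) (pder k h u) = 0.
Proof. exact: (dotv_pder_envelope oU sh seps hreg pe phiE). Qed.

Lemma envelope_ellipse u v : U u -> curvature_ellipse f (chart_inv c u) v ->
  dotv v (eps u) = 1 /\ forall i, dotv v (pder i phi u) = 0.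
Proof.
move=> Uu /(curvature_ellipseP f_immersion ac _ Uu)[s [t [w0 ->]]].
rewrite -/phi in w0 *; split=> [|i].
  rewrite dotvZl dotv_sff_quad -/phi.
  rewrite !(dotv_sff_envelope_eps oU sh seps hreg epsE pe phiE _ _ Uu).
  rewrite -dotvv_eq0 in w0; rewrite -[RHS](mulVf w0); congr (_ * _).
  by rewrite !dotvDl !dotvDr !dotvZl !dotvZr (dotvC (d2 phi u) (d1 phi u)); ring.
rewrite dotvZl dotv_sff_quad -/phi.
by rewrite !(dotv_sff_envelope_orth phireg _ _ _ Uu) !mulr0 !addr0 mulr0.
Qed.

Lemma normal_space_envelope u v : U u ->
  (forall i, dotv v (pder i phi u) = 0) -> normal_space f (chart_inv c u) v.
Proof. by move=> Uu v0; apply/(normal_spaceP f_immersion ac). Qed.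

Lemma envelope_semiumbilic u : U u -> semiumbilic_at f (chart_inv c u).
Proof.
move=> Uu; set p := dotv (d1 h u) (eps u); set q := dotv (d2 h u) (eps u).
(* The line [v . eps = 1] in the tangent plane of the surface: [a0] is its point nearest the origin,
   and [d] is a tangent direction orthogonal to [eps]. *)
pose d := q *: d1 h u - p *: d2 h u; pose a0 := (dotv (eps u) (eps u))^-1 *: eps u.
have eps0 : eps u != 0 := eps_neq0 oU sh seps hreg epsE pe phiE phireg Uu.
have eps2 : dotv (eps u) (eps u) != 0 by rewrite dotvv_eq0.
have epsphi i : dotv (eps u) (pder i phi u) = 0.
  exact: (dotv_eps_envelope oU sh seps hreg epsE pe phiE).
have pq0 : p ^+ 2 + q ^+ 2 != 0.
  apply: contra_neq eps2 => /eqP; rewrite paddr_eq0 ?sqr_ge0// !sqrf_eq0.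
  move=> /andP[/eqP p0 /eqP q0]; rewrite {1}(epsE Uu) dotvDl !dotvZl -/p -/q.
  by rewrite p0 q0 !mulr0 addr0.
have d0 : d != 0.
  apply: contra_neq pq0 => dE.
  have [-> /eqP] : q = 0 /\ - p = 0.
    by apply: (comb_inj (hreg Uu)); rewrite !scale0r addr0 scaleNr.
  by rewrite oppr_eq0 => /eqP ->; rewrite expr2 mul0r addr0.
have a0phi i : dotv a0 (pder i phi u) = 0 by rewrite dotvZl epsphi mulr0.
exists [set a0 + r *: d | r in [set: R]].
  exists a0, d; split => //; apply: normal_space_envelope => // i.
  by rewrite /d dotvDl dotvNl !dotvZl !(dotvC (pder _ h u)) !orth// !mulr0 subr0.
move=> v /(envelope_ellipse Uu)[v1 vphi]; pose z := v - a0.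
have : tproj h u z = z.
  apply: (tproj_orth oU sh seps hreg pe phiE phireg Uu) => i.
  by rewrite dotvDl dotvNl vphi a0phi subr0.
rewrite /tproj /plane_proj; set zl := coefl _ _ _; set zr := coefr _ _ _ => zE.
(* As [z] is orthogonal to [eps], its coordinates are orthogonal to [(p, q)], hence proportional to
   those of [d], namely [(q, - p)]. *)
have zpq : zl * p + zr * q = 0.
  rewrite -!dotvZl -dotvDl zE dotvDl dotvNl v1 dotvZl mulVf ?subrr//.
exists ((zl * q - zr * p) / (p ^+ 2 + q ^+ 2)) => //.
rewrite -(subrK a0 v) -/z addrC -zE /d scalerBr !scalerA; congr (_ + _).
have -> : (zl * q - zr * p) / (p ^+ 2 + q ^+ 2) * q = zl.
  apply: (mulIf pq0); rewrite mulrAC divfK//.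
  transitivity (zl * (p ^+ 2 + q ^+ 2) - p * (zl * p + zr * q)); first by ring.
  by rewrite zpq; ring.
have -> : (zl * q - zr * p) / (p ^+ 2 + q ^+ 2) * p = - zr.
  apply: (mulIf pq0); rewrite mulrAC divfK//.
  transitivity (- zr * (p ^+ 2 + q ^+ 2) + q * (zl * p + zr * q)); first by ring.
  by rewrite zpq; ring.
by rewrite scaleNr opprK.
Qed.

Lemma envelope_not_inflection u : U u -> ~ inflection_at f (chart_inv c u).
Proof.
move=> Uu [_ [[a0 [d [_ _ _ ->]]] [r0 _ r0E] sub]].
(* The only possible intersection of the line through the origin along [d] with the line
   [v . eps = 1]; any ellipse point shows that [d . eps] is nonzero. *)
pose m := (dotv d (eps u))^-1 *: d.
have mE v : curvature_ellipse f (chart_inv c u) v -> v = m.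
  move=> Ev; have [v1 _] := envelope_ellipse Uu Ev.
  have [r _ rE] := sub v Ev.
  have vd : v = (r - r0) *: d.
    by rewrite -rE -[LHS]subr0 -r0E opprD addrACA subrr add0r scalerBl.
  move: v1; rewrite vd dotvZl => rd.
  have d0 : dotv d (eps u) != 0.
    by apply/eqP => d0; move: rd; rewrite d0 mulr0 => /esym/eqP; rewrite oner_eq0.
  by rewrite /m; congr (_ *: _); apply: (mulIf d0); rewrite rd mulVf.
apply: (envelope_not_umbilic oU sh seps hreg epsE pe phiE phireg Uu (m := m)).
move=> i j; apply: dotv_inj => n; rewrite dotvZl mulrC.
by apply: ellipse_dotv_const => // v /mE ->.
Qed.

Lemma gauss_envelope_semiumbilic u : U u -> semiumbilic_at x (chart_inv c u) ->
  gauss phi u = 0.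
Proof.
move=> Uu [_ [a0 [d [_ /(normal_spaceP x_immersion ac _ Uu)[dl dr] d0 ->]]] sub].
rewrite -/h in dl dr.
(* Chosen so that [n = p phi_1 + q phi_2] is a normal vector orthogonal to [d]; [v . n] is then
   constant along the line. If [p = q = 0], then [d] would be orthogonal to all of [R^4]. *)
pose p := dotv (d2 phi u) d; pose q := - dotv (d1 phi u) d.
pose n := p *: d1 phi u + q *: d2 phi u.
have dn : dotv d n = 0.
  by rewrite /n dotvDr !dotvZr /p /q (dotvC d) (dotvC d); ring.
have nh i : dotv n (pder i h u) = 0.
  by rewrite dotvDl !dotvZl !orth// !mulr0 addr0.
have En v : curvature_ellipse x (chart_inv c u) v -> dotv v n = dotv a0 n.
  by move=> /sub[r _ <-]; rewrite dotvDl dotvZl dn mulr0 addr0.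
have Sn := ellipse_dotv_const x_immersion ac Uu En; rewrite -/h in Sn.
apply: (gauss_envelope_eq0 oU sh seps hreg pe phiE phireg Uu (p := p) (q := q)
  (k := - dotv a0 n)).
  apply: contra_neq d0 => -[p0 /eqP]; rewrite oppr_eq0 => /eqP q0.
  apply: (eq0_of_orth oU sh seps hreg pe phiE phireg Uu) => i.
    by have [->|->] := ord2P i.
  by have [->|->] := ord2P i; rewrite dotvC.
(* The sign of the factor [- dotv a0 n] comes from [phi_j . h_ik] being minus the cubic form. *)
move=> i j; rewrite [RHS]mulNr -Sn /sff dotv_perp_orth// dotvDr !dotvZr.
rewrite !(dotvC (pder i _ u)).
by rewrite !(dotv_envelope_pder2 oU sh seps hreg pe phiE _ _ _ Uu); ring.
Qed.

End EnvelopeInChart.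

(** * Passage from chart computations to every point of the surface *)

Theorem theorem4p6 (R : realType) (M : smoothSurface R)
    (x : M -> 'rV[R]_4) (x_immersion : immersion x)
    (e : M -> 'rV[R]_4) (e_field : tangent_field x e)
    (nabla_e : forall X : M -> 'rV[R]_4, tangent_field x X ->
                 forall p : M, nabla x X e p = X p)
    (f : M -> 'rV[R]_4) (fE : forall p : M, f p = x p - e p) :
  flat x /\
  (immersion f -> semiumbilical f /\ (semiumbilical x -> flat f)).
Proof.
split.
  move=> X Y Z tX tY tZ p; have [c [u [ac Uu ->]]] := chart_point p.
  apply: curvature_eq0 => //.
  exact: (gauss_surface_eq0 x_immersion e_field nabla_e fE ac Uu).
move=> f_immersion.
split=> [p|semi_x X Y Z tX tY tZ p]; have [c [u [ac Uu ->]]] := chart_point p.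
  split.
    exact: (envelope_semiumbilic x_immersion e_field nabla_e fE ac f_immersion Uu).
  exact: (envelope_not_inflection x_immersion e_field nabla_e fE ac f_immersion Uu).
apply: curvature_eq0 => //.
apply: (gauss_envelope_semiumbilic x_immersion e_field nabla_e fE ac f_immersion Uu).
exact: (semi_x _).1.
Qed.
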